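(* The functor $\mathrm{Cnr}(-):\mathrm{CodDiscr}\to\mathcal{SFS}$, sending a codomain-discrete double category $X$ to the category of corners $\mathrm{Cnr}(X)$ equipped with the strict factorization system $(\mathcal{E}_X,\mathcal{M}_X)$, and the functor $D:\mathcal{SFS}\to\mathrm{CodDiscr}$, sending a strict factorization system $(\mathcal{E},\mathcal{M})$ on a category $\mathcal{C}$ to the double category $D_{\mathcal{E},\mathcal{M}}$, are mutually inverse equivalences of categories (i.e. there are natural isomorphisms $1\cong D\circ\mathrm{Cnr}(-)$ and $\mathrm{Cnr}(-)\circ D\cong 1$). Hence $\mathcal{SFS}\simeq\mathrm{CodDiscr}$.
   Context: Double categories. A double category $X$ is an internal category in $\mathrm{Cat}$, with categories $X_0,X_1,X_2$ and functors $d_0,d_1:X_1\to X_0$ (codomain, resp. domain), $s:X_0\to X_1$, $d_1:X_2\to X_1$ (composition). Objects of $X_0$ are the objects of $X$, morphisms of $X_0$ the vertical morphisms, objects of $X_1$ the horizontal morphisms, morphisms of $X_1$ the squares. A square $\alpha:g\to h$ in $X_1$ has top horizontal edge $g:a\to b$, bottom horizontal edge $h:c\to d$, left vertical edge $d_1(\alpha):a\to c$ and right vertical edge $d_0(\alpha):b\to d$. $\mathrm{Dbl}$ is the category of double categories and double functors. Codomain-discrete. $X$ is codomain-discrete if for every horizontal $g:a\to b$ and vertical $u:b\to c$ there is a unique square with top edge $g$ and right edge $u$. $\mathrm{CodDiscr}\subseteq\mathrm{Dbl}$ is the full subcategory of codomain-discrete double categories. Category of corners (for codomain-discrete $X$).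 $\mathrm{Cnr}(X)$ has the objects of $X$ as objects; a morphism $a\to b$ is a pair $[u,g]$ with $u:a\to a'$ vertical and $g:a'\to b$ horizontal (for codomain-discrete $X$ no further identification is made). The identity is $[1_a,1_a]$. The composite $[v,h]\circ[u,g]$, with $g:a'\to b$ and $v:b\to b'$, is $[\hat v\circ u,\,h\circ\hat g]$ where $\hat v$ (left edge) and $\hat g$ (bottom edge) come from the unique square with top edge $g$ and right edge $v$. A double functor $F:X\to Y$ induces $\mathrm{Cnr}(F)$, $[u,g]\mapsto[Fu,Fg]$. $\mathcal{E}_X$ is the class of morphisms of the form $[u,1]$, $\mathcal{M}_X$ the class of those of the form $[1,g]$. Strict factorization systems. A strict factorization system $(\mathcal{E},\mathcal{M})$ on a category $\mathcal{C}$ consists of two wide subcategories $\mathcal{E},\mathcal{M}\subseteq\mathcal{C}$ such that every morphism $f$ of $\mathcal{C}$ can be written as $f=m\circ e$ for unique $e\in\mathcal{E}$, $m\in\mathcal{M}$. $\mathcal{SFS}$ has as objects strict factorization systems $(\mathcal{E}\subseteq\mathcal{C}\supseteq\mathcal{M})$ and as morphisms to $(\mathcal{E}'\subseteq\mathcal{C}'\supseteq\mathcal{M}')$ the functors $F:\mathcal{C}\to\mathcal{C}'$ with $F(\mathcal{E})\subseteq\mathcal{E}'$, $F(\mathcal{M})\subseteq\mathcal{M}'$. The double category $D_{\mathcal{E},\mathcal{M}}$ has the objects of $\mathcal{C}$ as objects, $\mathcal{E}$ as the category of objects and vertical morphisms, $\mathcal{M}$ as the category of objects and horizontal morphisms,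 and as squares the commutative squares in $\mathcal{C}$. A functor preserving the two classes induces a double functor in the obvious way. *)

(* Defs.v *)
From Stdlib Require Import ProofIrrelevance FunctionalExtensionality ClassicalEpsilon.

Set Implicit Arguments.
Unset Strict Implicit.
Unset Printing Implicit Defensive.
Local Obligation Tactic := idtac.

Record Category := {
  Obj : Type;
  Hom : Obj -> Obj -> Type;
  Id : forall a, Hom a a;
  Comp : forall a b c, Hom b c -> Hom a b -> Hom a c;
  Comp_id_r : forall a b (f : Hom a b), Comp f (Id a) = f;
  Comp_id_l : forall a b (f : Hom a b), Comp (Id b) f = f;
  Comp_assoc : forall a b c d (h : Hom c d) (g : Hom b c) (f : Hom a b),
      Comp (Comp h g) f = Comp h (Comp g f)
}.
Arguments Hom : clear implicits.

Record Functor (A B : Category) := {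
  FOb :> Obj A -> Obj B;
  FHom : forall a b, Hom A a b -> Hom B (FOb a) (FOb b);
  FHom_id : forall a, FHom (Id a) = Id (FOb a);
  FHom_comp : forall a b c (g : Hom A b c) (f : Hom A a b),
      FHom (Comp g f) = Comp (FHom g) (FHom f)
}.

Program Definition FunctorId (A : Category) : Functor A A :=
  {| FOb := fun a => a; FHom := fun _ _ f => f |}.
Next Obligation. reflexivity. Qed.
Next Obligation. reflexivity. Qed.

Program Definition FunctorComp (A B C : Category)
  (G : Functor B C) (F : Functor A B) : Functor A C :=
  {| FOb := fun a => G (F a); FHom := fun _ _ f => FHom G (FHom F f) |}.
Next Obligation. intros; simpl; now rewrite !FHom_id. Qed.
Next Obligation. intros; simpl; now rewrite !FHom_comp. Qed.

Record NatIso (A B : Category) (F G : Functor A B) := {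
  ni_to : forall a, Hom B (F a) (G a);
  ni_from : forall a, Hom B (G a) (F a);
  ni_natural : forall a b (f : Hom A a b),
      Comp (ni_to b) (FHom F f) = Comp (FHom G f) (ni_to a);
  ni_from_to : forall a, Comp (ni_from a) (ni_to a) = Id (F a);
  ni_to_from : forall a, Comp (ni_to a) (ni_from a) = Id (G a)
}.

Definition NatIsomorphic (A B : Category) (F G : Functor A B) : Prop :=
  inhabited (NatIso F G).

Definition MutuallyInverse (A B : Category) (F : Functor A B) (G : Functor B A) : Prop :=
  NatIsomorphic (FunctorId A) (FunctorComp G F) /\
  NatIsomorphic (FunctorComp F G) (FunctorId B).

Definition EquivalentCategories (A B : Category) : Prop :=
  exists (F : Functor A B) (G : Functor B A), MutuallyInverse F G.

Program Definition FullSubcategory (A : Category) (P : Obj A -> Prop) : Category :=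
  {| Obj := {a : Obj A | P a};
     Hom := fun a b => Hom A (proj1_sig a) (proj1_sig b);
     Id := fun a => Id (proj1_sig a);
     Comp := fun _ _ _ g f => Comp g f |}.
Next Obligation. intros; apply Comp_id_r. Qed.
Next Obligation. intros; apply Comp_id_l. Qed.
Next Obligation. intros; apply Comp_assoc. Qed.

(** The categories that occur inside a double category, or carry a strict
    factorization system, have one type of arrows with domain and codomain maps.
    A category internal to small categories involves pullbacks of categories and
    equations between objects and between functors; in this presentation they need
    no transport of arrows along equalities of objects. *)

Record SmallCat := {
  Ob : Type;
  Mor : Type;
  dom : Mor -> Ob;
  cod : Mor -> Ob;
  idm : Ob -> Mor;
  comp : forall g f : Mor, cod f = dom g -> Mor;
  dom_idm : forall a, dom (idm a) = a;
  cod_idm : forall a, cod (idm a) = a;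
  dom_comp : forall g f p, dom (@comp g f p) = dom f;
  cod_comp : forall g f p, cod (@comp g f p) = cod g;
  comp_id_r : forall f p, @comp f (idm (dom f)) p = f;
  comp_id_l : forall f p, @comp (idm (cod f)) f p = f;
  comp_assoc : forall h g f (p : cod f = dom g) (q : cod g = dom h) p' q',
      @comp (comp q) f p' = @comp h (comp p) q'
}.
Arguments Ob : clear implicits.
Arguments Mor : clear implicits.
Arguments dom {_} _.
Arguments cod {_} _.
Arguments idm {_} _.
Arguments comp {_} g f _.

Record SmallFunctor (C D : SmallCat) := {
  fob : Ob C -> Ob D;
  fmor : Mor C -> Mor D;
  dom_fmor : forall f, dom (fmor f) = fob (dom f);
  cod_fmor : forall f, cod (fmor f) = fob (cod f);
  fmor_id : forall a, fmor (idm a) = idm (fob a);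
  fmor_comp : forall g f p q, fmor (comp g f p) = comp (fmor g) (fmor f) q
}.

Arguments fmor_comp {C D} _ {g f p q}.

Lemma comp_ext (C : SmallCat) (g g' f f' : Mor C) p p' :
  g = g' -> f = f' -> comp g f p = comp g' f' p'.
Proof. intros -> ->; f_equal; apply proof_irrelevance. Qed.

Lemma sf_ext (C D : SmallCat) (F G : SmallFunctor C D) :
  (forall a, fob F a = fob G a) -> (forall f, fmor F f = fmor G f) -> F = G.
Proof.
destruct F as [F0 F1 ? ? ? ?], G as [G0 G1 ? ? ? ?]; simpl; intros H0 H1.
apply functional_extensionality in H0; apply functional_extensionality in H1.
subst; f_equal; apply proof_irrelevance.
Qed.

Program Definition sf_id (C : SmallCat) : SmallFunctor C C :=
  {| fob := fun a => a; fmor := fun f => f |}.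
Next Obligation. reflexivity. Qed.
Next Obligation. reflexivity. Qed.
Next Obligation. reflexivity. Qed.
Next Obligation. intros; now apply comp_ext. Qed.

Program Definition sf_comp (A B C : SmallCat)
  (G : SmallFunctor B C) (F : SmallFunctor A B) : SmallFunctor A C :=
  {| fob := fun a => fob G (fob F a); fmor := fun f => fmor G (fmor F f) |}.
Next Obligation. intros; simpl; now rewrite !dom_fmor. Qed.
Next Obligation. intros; simpl; now rewrite !cod_fmor. Qed.
Next Obligation. intros; simpl; now rewrite !fmor_id. Qed.
Next Obligation.
intros A B C G F g f p q; simpl.
assert (r : cod (fmor F f) = dom (fmor F g)) by now rewrite dom_fmor, cod_fmor, p.
rewrite (fmor_comp F (q := r)); apply fmor_comp.
Qed.

Lemma sig_ext (T : Type) (P : T -> Prop) (x y : {t | P t}) :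
  proj1_sig x = proj1_sig y -> x = y.
Proof.
destruct x as [x p], y as [y q]; simpl; intros ->; f_equal; apply proof_irrelevance.
Qed.

Section Pullback.
Variables (A B C : SmallCat) (F : SmallFunctor A C) (G : SmallFunctor B C).

Definition PbOb := {x : Ob A * Ob B | fob F (fst x) = fob G (snd x)}.
Definition PbMor := {x : Mor A * Mor B | fmor F (fst x) = fmor G (snd x)}.

Program Definition Pullback : SmallCat :=
  {| Ob := PbOb;
     Mor := PbMor;
     dom := fun f => exist _ (dom (fst (proj1_sig f)), dom (snd (proj1_sig f))) _;
     cod := fun f => exist _ (cod (fst (proj1_sig f)), cod (snd (proj1_sig f))) _;
     idm := fun a => exist _ (idm (fst (proj1_sig a)), idm (snd (proj1_sig a))) _;
     comp := fun g f p =>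
       exist _ (comp (fst (proj1_sig g)) (fst (proj1_sig f)) _,
                comp (snd (proj1_sig g)) (snd (proj1_sig f)) _) _ |}.
Next Obligation. intros [[f g] e]; simpl in *; now rewrite <- !dom_fmor, e. Qed.
Next Obligation. intros [[f g] e]; simpl in *; now rewrite <- !cod_fmor, e. Qed.
Next Obligation. intros [[a b] e]; simpl in *; now rewrite !fmor_id, e. Qed.
Next Obligation. intros g f p; now injection p. Qed.
Next Obligation. intros g f p; now injection p. Qed.
Next Obligation.
intros [[g g'] e] [[f f'] e'] p; simpl in *.
injection p as p1 p2.
assert (q : cod (fmor F f) = dom (fmor F g)) by now rewrite dom_fmor, cod_fmor, p1.
assert (q' : cod (fmor G f') = dom (fmor G g')) by now rewrite dom_fmor, cod_fmor, p2.
rewrite (fmor_comp F (q := q)), (fmor_comp G (q := q')); now apply comp_ext.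
Qed.
Next Obligation.
intros [[a b] e]; apply sig_ext; simpl; now rewrite !dom_idm.
Qed.
Next Obligation.
intros [[a b] e]; apply sig_ext; simpl; now rewrite !cod_idm.
Qed.
Next Obligation. intros g f p; apply sig_ext; simpl; now rewrite !dom_comp. Qed.
Next Obligation. intros g f p; apply sig_ext; simpl; now rewrite !cod_comp. Qed.
Next Obligation. intros [[f f'] e] p; apply sig_ext; simpl; now rewrite !comp_id_r. Qed.
Next Obligation. intros [[f f'] e] p; apply sig_ext; simpl; now rewrite !comp_id_l. Qed.
Next Obligation.
intros h g f p q p' q'; apply sig_ext; simpl; f_equal; apply comp_assoc.
Qed.

Program Definition pb_fst : SmallFunctor Pullback A :=
  {| fob := fun x : Ob Pullback => fst (proj1_sig x);
     fmor := fun f : Mor Pullback => fst (proj1_sig f) |}.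
Next Obligation. reflexivity. Qed.
Next Obligation. reflexivity. Qed.
Next Obligation. reflexivity. Qed.
Next Obligation. intros; simpl; now apply comp_ext. Qed.

Program Definition pb_snd : SmallFunctor Pullback B :=
  {| fob := fun x : Ob Pullback => snd (proj1_sig x);
     fmor := fun f : Mor Pullback => snd (proj1_sig f) |}.
Next Obligation. reflexivity. Qed.
Next Obligation. reflexivity. Qed.
Next Obligation. reflexivity. Qed.
Next Obligation. intros; simpl; now apply comp_ext. Qed.

Program Definition pb_pair (T : SmallCat) (H : SmallFunctor T A) (K : SmallFunctor T B)
  (e : sf_comp F H = sf_comp G K) : SmallFunctor T Pullback :=
  {| fob := fun x => exist _ (fob H x, fob K x) _;
     fmor := fun f => exist _ (fmor H f, fmor K f) _ |}.
Next Obligation. intros T H K e x; exact (f_equal (fun S => fob S x) e). Qed.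
Next Obligation. intros T H K e x; exact (f_equal (fun S => fmor S x) e). Qed.
Next Obligation. intros; apply sig_ext; simpl; now rewrite !dom_fmor. Qed.
Next Obligation. intros; apply sig_ext; simpl; now rewrite !cod_fmor. Qed.
Next Obligation. intros; apply sig_ext; simpl; now rewrite !fmor_id. Qed.
Next Obligation. intros; apply sig_ext; simpl; f_equal; apply fmor_comp. Qed.

End Pullback.

(** Categories internal to small categories.  An object of
    [Pullback d0 d1] is a pair [(g, h)] of horizontal morphisms with the codomain
    of [g] equal to the domain of [h], and [hcomp] sends it to [h ∘ g].
    The equations between functors quantified over in the unit and associativity
    laws follow from the four preceding laws, and the one in [df_hcomp] below is
    [df_pair_eq]. *)
Record DoubleCat := {
  X0 : SmallCat;
  X1 : SmallCat;
  d0 : SmallFunctor X1 X0;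
  d1 : SmallFunctor X1 X0;
  hunit : SmallFunctor X0 X1;
  hcomp : SmallFunctor (Pullback d0 d1) X1;
  d0_hunit : sf_comp d0 hunit = sf_id X0;
  d1_hunit : sf_comp d1 hunit = sf_id X0;
  d0_hcomp : sf_comp d0 hcomp = sf_comp d0 (pb_snd d0 d1);
  d1_hcomp : sf_comp d1 hcomp = sf_comp d1 (pb_fst d0 d1);
  hcomp_unit_dom : forall e,
      sf_comp hcomp (@pb_pair _ _ _ d0 d1 _ (sf_comp hunit d1) (sf_id X1) e) = sf_id X1;
  hcomp_unit_cod : forall e,
      sf_comp hcomp (@pb_pair _ _ _ d0 d1 _ (sf_id X1) (sf_comp hunit d0) e) = sf_id X1;
  hcomp_assoc :
    let X2 := Pullback d0 d1 in
    let X3 := Pullback (sf_comp d0 (pb_snd d0 d1)) d1 in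
    let p12 : SmallFunctor X3 X2 := pb_fst _ _ in
    let p1 : SmallFunctor X3 X1 := sf_comp (pb_fst d0 d1) p12 in
    let p2 : SmallFunctor X3 X1 := sf_comp (pb_snd d0 d1) p12 in
    let p3 : SmallFunctor X3 X1 := pb_snd _ _ in
    forall e e' e'',
      sf_comp hcomp (@pb_pair _ _ _ d0 d1 _ (sf_comp hcomp p12) p3 e) =
      sf_comp hcomp (@pb_pair _ _ _ d0 d1 _ p1
                       (sf_comp hcomp (@pb_pair _ _ _ d0 d1 _ p2 p3 e')) e'')
}.
Arguments d0 {_}.
Arguments d1 {_}.
Arguments hunit {_}.
Arguments hcomp {_}.

Definition hpair (X : DoubleCat) (g h : Ob (X1 X)) (p : fob d0 g = fob d1 h)
  : Ob (Pullback (@d0 X) (@d1 X)) := exist _ (g, h) p.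
Definition sqpair (X : DoubleCat) (a b : Mor (X1 X)) (p : fmor d0 a = fmor d1 b)
  : Mor (Pullback (@d0 X) (@d1 X)) := exist _ (a, b) p.
(** [hcomp_ob p] is the composite [h ∘ g] of horizontal morphisms, and [hcomp_sq p]
    the square obtained by pasting [a] (on the left) with [b] along their common
    vertical edge. *)
Definition hcomp_ob (X : DoubleCat) (g h : Ob (X1 X)) (p : fob d0 g = fob d1 h)
  : Ob (X1 X) := fob hcomp (hpair p).
Definition hcomp_sq (X : DoubleCat) (a b : Mor (X1 X)) (p : fmor d0 a = fmor d1 b)
  : Mor (X1 X) := fmor hcomp (sqpair p).

Record DoubleFunctor (X Y : DoubleCat) := {
  df0 : SmallFunctor (X0 X) (X0 Y);
  df1 : SmallFunctor (X1 X) (X1 Y);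
  df_d0 : sf_comp d0 df1 = sf_comp df0 d0;
  df_d1 : sf_comp d1 df1 = sf_comp df0 d1;
  df_hunit : sf_comp df1 hunit = sf_comp hunit df0;
  df_hcomp : forall e,
      sf_comp df1 hcomp =
      sf_comp hcomp (@pb_pair _ _ _ (@d0 Y) (@d1 Y) _
        (sf_comp df1 (pb_fst d0 d1)) (sf_comp df1 (pb_snd d0 d1)) e)
}.

Lemma df_ext (X Y : DoubleCat) (F G : DoubleFunctor X Y) :
  df0 F = df0 G -> df1 F = df1 G -> F = G.
Proof.
destruct F, G; simpl; intros -> ->; f_equal; apply proof_irrelevance.
Qed.

Section DoubleCatTheory.
Variable X : DoubleCat.
Implicit Types (g h k : Ob (X1 X)) (a b c : Mor (X1 X)).

Lemma d0u x : fob d0 (fob (@hunit X) x) = x.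
Proof. exact (f_equal (fun S => fob S x) (d0_hunit X)). Qed.
Lemma d0um u : fmor d0 (fmor (@hunit X) u) = u.
Proof. exact (f_equal (fun S => fmor S u) (d0_hunit X)). Qed.
Lemma d1u x : fob d1 (fob (@hunit X) x) = x.
Proof. exact (f_equal (fun S => fob S x) (d1_hunit X)). Qed.
Lemma d1um u : fmor d1 (fmor (@hunit X) u) = u.
Proof. exact (f_equal (fun S => fmor S u) (d1_hunit X)). Qed.
Lemma d0h g h p : fob d0 (@hcomp_ob X g h p) = fob d0 h.
Proof. exact (f_equal (fun S => fob S (hpair p)) (d0_hcomp X)). Qed.
Lemma d0hm a b p : fmor d0 (@hcomp_sq X a b p) = fmor d0 b.
Proof. exact (f_equal (fun S => fmor S (sqpair p)) (d0_hcomp X)). Qed.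
Lemma d1h g h p : fob d1 (@hcomp_ob X g h p) = fob d1 g.
Proof. exact (f_equal (fun S => fob S (hpair p)) (d1_hcomp X)). Qed.
Lemma d1hm a b p : fmor d1 (@hcomp_sq X a b p) = fmor d1 a.
Proof. exact (f_equal (fun S => fmor S (sqpair p)) (d1_hcomp X)). Qed.

Lemma hcomp_ob_ext g g' h h' p p' :
  g = g' -> h = h' -> @hcomp_ob X g h p = @hcomp_ob X g' h' p'.
Proof. intros -> ->; f_equal; apply proof_irrelevance. Qed.
Lemma hcomp_sq_ext a a' b b' p p' :
  a = a' -> b = b' -> @hcomp_sq X a b p = @hcomp_sq X a' b' p'.
Proof. intros -> ->; f_equal; apply proof_irrelevance. Qed.

Lemma dom_hcomp_sq a b p q :
  dom (@hcomp_sq X a b p) = @hcomp_ob X (dom a) (dom b) q.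
Proof.
unfold hcomp_sq, sqpair; rewrite dom_fmor; unfold hcomp_ob, hpair; f_equal; now apply sig_ext.
Qed.
Lemma cod_hcomp_sq a b p q :
  cod (@hcomp_sq X a b p) = @hcomp_ob X (cod a) (cod b) q.
Proof.
unfold hcomp_sq, sqpair; rewrite cod_fmor; unfold hcomp_ob, hpair; f_equal; now apply sig_ext.
Qed.

Lemma hunit_dom g x p : x = fob d1 g -> @hcomp_ob X (fob hunit x) g p = g.
Proof.
intros ->.
assert (e : sf_comp d0 (sf_comp hunit d1) = sf_comp d1 (sf_id (X1 X))).
{ apply sf_ext; intros; simpl; [apply d0u | apply d0um]. }
rewrite <- (f_equal (fun S => fob S g) (hcomp_unit_dom e)) at 3.
unfold hcomp_ob, hpair; simpl; f_equal; now apply sig_ext.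
Qed.
Lemma hunit_cod g x p : x = fob d0 g -> @hcomp_ob X g (fob hunit x) p = g.
Proof.
intros ->.
assert (e : sf_comp d0 (sf_id (X1 X)) = sf_comp d1 (sf_comp hunit d0)).
{ apply sf_ext; intros; simpl; symmetry; [apply d1u | apply d1um]. }
rewrite <- (f_equal (fun S => fob S g) (hcomp_unit_cod e)) at 3.
unfold hcomp_ob, hpair; simpl; f_equal; now apply sig_ext.
Qed.

Lemma hassoc g h k p q p' q' :
  @hcomp_ob X (@hcomp_ob X g h p) k q' = @hcomp_ob X g (@hcomp_ob X h k q) p'.
Proof.
pose (P2 := Pullback (@d0 X) (@d1 X)).
pose (P3 := Pullback (sf_comp (@d0 X) (pb_snd d0 d1)) (@d1 X)).
pose (p12 := pb_fst _ _ : SmallFunctor P3 P2).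
pose (p3 := pb_snd _ _ : SmallFunctor P3 (X1 X)).
assert (e : sf_comp d0 (sf_comp hcomp p12) = sf_comp d1 p3).
{ apply sf_ext; intros [[[[x y] ?] z] E]; simpl in *;
    [rewrite <- E; apply d0h | rewrite <- E; apply d0hm]. }
assert (e' : sf_comp d0 (sf_comp (pb_snd d0 d1) p12) = sf_comp d1 p3).
{ apply sf_ext; intros [[[[x y] ?] z] E]; exact E. }
assert (e'' : sf_comp d0 (sf_comp (pb_fst d0 d1) p12)
              = sf_comp d1 (sf_comp hcomp (pb_pair e'))).
{ apply sf_ext; intros [[[[x y] E0] z] E]; simpl in *;
    (etransitivity; [exact E0|]); symmetry; [apply d1h | apply d1hm]. }
pose (x := exist (fun y : Ob P2 * Ob (X1 X) =>
  fob d0 (snd (proj1_sig (fst y))) = fob d1 (snd y)) (hpair p, k) q : Ob P3).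
pose proof (f_equal (fun S => fob S x) (hcomp_assoc e e'')) as H.
simpl in H.
etransitivity; [etransitivity; [|exact H]|];
  unfold hcomp_ob, hpair; f_equal; apply sig_ext; simpl; trivial.
do 2 f_equal; now apply sig_ext.
Qed.
End DoubleCatTheory.

Section DoubleFunctorTheory.
Variables (X Y : DoubleCat) (F : DoubleFunctor X Y).

Lemma dfd0 g : fob d0 (fob (df1 F) g) = fob (df0 F) (fob d0 g).
Proof. exact (f_equal (fun S => fob S g) (df_d0 F)). Qed.
Lemma dfd0m a : fmor d0 (fmor (df1 F) a) = fmor (df0 F) (fmor d0 a).
Proof. exact (f_equal (fun S => fmor S a) (df_d0 F)). Qed.
Lemma dfd1 g : fob d1 (fob (df1 F) g) = fob (df0 F) (fob d1 g).
Proof. exact (f_equal (fun S => fob S g) (df_d1 F)). Qed.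
Lemma dfd1m a : fmor d1 (fmor (df1 F) a) = fmor (df0 F) (fmor d1 a).
Proof. exact (f_equal (fun S => fmor S a) (df_d1 F)). Qed.
Lemma dfu x : fob (df1 F) (fob hunit x) = fob hunit (fob (df0 F) x).
Proof. exact (f_equal (fun S => fob S x) (df_hunit F)). Qed.
Lemma dfum u : fmor (df1 F) (fmor hunit u) = fmor hunit (fmor (df0 F) u).
Proof. exact (f_equal (fun S => fmor S u) (df_hunit F)). Qed.

Lemma df_pair_eq :
  sf_comp d0 (sf_comp (df1 F) (pb_fst d0 d1)) = sf_comp d1 (sf_comp (df1 F) (pb_snd d0 d1)).
Proof.
apply sf_ext; intros [[a b] e]; simpl in *.
- now rewrite dfd0, dfd1, e.
- now rewrite dfd0m, dfd1m, e.
Qed.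

Lemma dfh g h p q :
  fob (df1 F) (@hcomp_ob X g h p) = @hcomp_ob Y (fob (df1 F) g) (fob (df1 F) h) q.
Proof.
etransitivity; [exact (f_equal (fun S => fob S (hpair p)) (df_hcomp df_pair_eq))|].
unfold hcomp_ob, hpair; simpl; f_equal; now apply sig_ext.
Qed.
Lemma dfhm a b p q :
  fmor (df1 F) (@hcomp_sq X a b p) = @hcomp_sq Y (fmor (df1 F) a) (fmor (df1 F) b) q.
Proof.
etransitivity; [exact (f_equal (fun S => fmor S (sqpair p)) (df_hcomp df_pair_eq))|].
unfold hcomp_sq, sqpair; simpl; f_equal; now apply sig_ext.
Qed.
End DoubleFunctorTheory.

Program Definition df_id (X : DoubleCat) : DoubleFunctor X X :=
  {| df0 := sf_id _; df1 := sf_id _ |}.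
Next Obligation. intros; now apply sf_ext. Qed.
Next Obligation. intros; now apply sf_ext. Qed.
Next Obligation. intros; now apply sf_ext. Qed.
Next Obligation.
intros X e; apply sf_ext; intros [[a b] p]; simpl; f_equal; now apply sig_ext.
Qed.

Program Definition df_comp (X Y Z : DoubleCat)
  (G : DoubleFunctor Y Z) (F : DoubleFunctor X Y) : DoubleFunctor X Z :=
  {| df0 := sf_comp (df0 G) (df0 F); df1 := sf_comp (df1 G) (df1 F) |}.
Next Obligation.
intros; apply sf_ext; intros; simpl; [now rewrite !dfd0 | now rewrite !dfd0m].
Qed.
Next Obligation.
intros; apply sf_ext; intros; simpl; [now rewrite !dfd1 | now rewrite !dfd1m].
Qed.
Next Obligation.
intros; apply sf_ext; intros; simpl; [now rewrite !dfu | now rewrite !dfum].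
Qed.
Next Obligation.
intros X Y Z G F e; apply sf_ext; intros [[a b] p]; simpl in *.
- assert (q : fob d0 (fob (df1 F) a) = fob d1 (fob (df1 F) b)) by now rewrite dfd0, dfd1, p.
  assert (q' : fob d0 (fob (df1 G) (fob (df1 F) a)) = fob d1 (fob (df1 G) (fob (df1 F) b)))
    by now rewrite dfd0, dfd1, q.
  etransitivity; [exact (f_equal (fob (df1 G)) (dfh p q))|].
  etransitivity; [exact (dfh q q')|].
  unfold hcomp_ob, hpair; f_equal; now apply sig_ext.
- assert (q : fmor d0 (fmor (df1 F) a) = fmor d1 (fmor (df1 F) b)) by now rewrite dfd0m, dfd1m, p.
  assert (q' : fmor d0 (fmor (df1 G) (fmor (df1 F) a)) = fmor d1 (fmor (df1 G) (fmor (df1 F) b)))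
    by now rewrite dfd0m, dfd1m, q.
  etransitivity; [exact (f_equal (fmor (df1 G)) (dfhm p q))|].
  etransitivity; [exact (dfhm q q')|].
  unfold hcomp_sq, sqpair; f_equal; now apply sig_ext.
Qed.

Program Definition Dbl : Category :=
  {| Obj := DoubleCat; Hom := DoubleFunctor; Id := df_id; Comp := df_comp |}.
Next Obligation. intros; apply df_ext; now apply sf_ext. Qed.
Next Obligation. intros; apply df_ext; now apply sf_ext. Qed.
Next Obligation. intros; apply df_ext; now apply sf_ext. Qed.

(** The top, bottom, left and right edges of a square [a] are
    [dom a], [cod a], [fmor d1 a] and [fmor d0 a]. *)
Definition codomain_discrete (X : DoubleCat) : Prop :=
  forall (g : Ob (X1 X)) (u : Mor (X0 X)), fob d0 g = dom u ->
    exists! a : Mor (X1 X), dom a = g /\ fmor d0 a = u.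

Definition CodDiscr : Category := @FullSubcategory Dbl codomain_discrete.

Definition wide_subcategory (C : SmallCat) (P : Mor C -> Prop) : Prop :=
  (forall a, P (idm a)) /\ (forall g f p, P g -> P f -> P (comp g f p)).

Record StrictFactSys := {
  sfs_cat :> SmallCat;
  sfs_E : Mor sfs_cat -> Prop;
  sfs_M : Mor sfs_cat -> Prop;
  sfs_E_wide : wide_subcategory sfs_E;
  sfs_M_wide : wide_subcategory sfs_M;
  sfs_fact : forall f : Mor sfs_cat, exists! em : Mor sfs_cat * Mor sfs_cat,
      sfs_E (fst em) /\ sfs_M (snd em) /\
      exists p : cod (fst em) = dom (snd em), f = comp (snd em) (fst em) p
}.
Arguments sfs_E {_} _.
Arguments sfs_M {_} _.

Record SFSFunctor (S T : StrictFactSys) := {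
  sfs_functor :> SmallFunctor S T;
  sfs_functor_E : forall f, sfs_E f -> sfs_E (fmor sfs_functor f);
  sfs_functor_M : forall f, sfs_M f -> sfs_M (fmor sfs_functor f)
}.

Lemma sfsf_ext (S T : StrictFactSys) (F G : SFSFunctor S T) :
  sfs_functor F = sfs_functor G -> F = G.
Proof. destruct F, G; simpl; intros ->; f_equal; apply proof_irrelevance. Qed.

Program Definition sfsf_id (S : StrictFactSys) : SFSFunctor S S :=
  {| sfs_functor := sf_id S |}.
Next Obligation. trivial. Qed.
Next Obligation. trivial. Qed.

Program Definition sfsf_comp (S T U : StrictFactSys)
  (G : SFSFunctor T U) (F : SFSFunctor S T) : SFSFunctor S U :=
  {| sfs_functor := sf_comp G F |}.
Next Obligation. intros; simpl; now do 2 apply sfs_functor_E. Qed.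
Next Obligation. intros; simpl; now do 2 apply sfs_functor_M. Qed.

Program Definition SFS : Category :=
  {| Obj := StrictFactSys; Hom := SFSFunctor; Id := sfsf_id; Comp := sfsf_comp |}.
Next Obligation. intros; apply sfsf_ext; now apply sf_ext. Qed.
Next Obligation. intros; apply sfsf_ext; now apply sf_ext. Qed.
Next Obligation. intros; apply sfsf_ext; now apply sf_ext. Qed.

Section Corners.
Variables (X : DoubleCat) (HX : codomain_discrete X).

Definition filler (g : Ob (X1 X)) (u : Mor (X0 X)) (p : fob d0 g = dom u) : Mor (X1 X) :=
  proj1_sig (constructive_indefinite_description _ (HX p)).

Lemma filler_spec g u p : dom (@filler g u p) = g /\ fmor d0 (@filler g u p) = u.
Proof.
unfold filler; destruct (constructive_indefinite_description _ _) as [a [H ?]]; exact H.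
Qed.
Lemma dom_filler g u p : dom (@filler g u p) = g.
Proof. apply filler_spec. Qed.
Lemma d0_filler g u p : fmor d0 (@filler g u p) = u.
Proof. apply filler_spec. Qed.
Lemma filler_unique g u p a : dom a = g -> fmor d0 a = u -> @filler g u p = a.
Proof.
intros H1 H2; destruct (HX p) as [b [_ Hb]].
rewrite <- (Hb _ (filler_spec p)); now apply Hb.
Qed.
Lemma filler_ext g g' u u' p p' : g = g' -> u = u' -> @filler g u p = @filler g' u' p'.
Proof. intros -> ->; f_equal; apply proof_irrelevance. Qed.

(** The pair [(u, g)] is the corner [[u, g]] from [dom u] to [fob d0 g]. *)
Definition Corner := {x : Mor (X0 X) * Ob (X1 X) | cod (fst x) = fob d1 (snd x)}.
Definition cvert (f : Corner) : Mor (X0 X) := fst (proj1_sig f).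
Definition chor (f : Corner) : Ob (X1 X) := snd (proj1_sig f).

Lemma corner_ext (f f' : Corner) : cvert f = cvert f' -> chor f = chor f' -> f = f'.
Proof.
destruct f as [[u g] p], f' as [[u' g'] p']; unfold cvert, chor; simpl.
intros -> ->; now apply sig_ext.
Qed.

Lemma corner_eq (f : Corner) : cod (cvert f) = fob d1 (chor f).
Proof. exact (proj2_sig f). Qed.

Lemma left_filler_eq g u p (v : Mor (X0 X)) :
  cod v = fob d1 g -> cod v = dom (fmor d1 (@filler g u p)).
Proof. intros ->; now rewrite dom_fmor, dom_filler. Qed.

Lemma bottom_filler_eq g u p h :
  cod u = fob d1 h -> fob d0 (cod (@filler g u p)) = fob d1 h.
Proof. intros <-; now rewrite <- cod_fmor, d0_filler. Qed.

Lemma corner_comp_eq g u p v q h r :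
  cod (comp (fmor d1 (@filler g u p)) v q) =
  fob d1 (@hcomp_ob X (cod (@filler g u p)) h r).
Proof. now rewrite cod_comp, cod_fmor, d1h. Qed.

(** [[v, h] ∘ [u, g] = [v^ ∘ u, h ∘ g^]], for [v^] the left and [g^] the bottom edge
    of the filler of [g] and [v]. *)
Definition corner_comp (f' f : Corner) (p : fob d0 (chor f) = dom (cvert f')) : Corner :=
  let a := filler p in
  exist _
    (comp (fmor d1 a) (cvert f) (left_filler_eq p (corner_eq f)),
     hcomp_ob (bottom_filler_eq p (corner_eq f')))
    (corner_comp_eq (left_filler_eq p (corner_eq f)) (bottom_filler_eq p (corner_eq f'))).

Definition corner_id (a : Ob (X0 X)) : Corner :=
  exist _ (idm a, fob hunit a) (eq_trans (cod_idm a) (eq_sym (d1u a))).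

Lemma cvert_comp f' f p a q :
  dom a = chor f -> fmor d0 a = cvert f' ->
  cvert (@corner_comp f' f p) = comp (fmor d1 a) (cvert f) q.
Proof.
intros H1 H2; unfold corner_comp, cvert at 1; simpl; apply comp_ext; trivial.
now rewrite (filler_unique p H1 H2).
Qed.

Lemma chor_comp f' f p a q :
  dom a = chor f -> fmor d0 a = cvert f' ->
  chor (@corner_comp f' f p) = @hcomp_ob X (cod a) (chor f') q.
Proof.
intros H1 H2; unfold corner_comp, chor at 1; simpl; apply hcomp_ob_ext; trivial.
now rewrite (filler_unique p H1 H2).
Qed.

Lemma cvert_comp_id f' f p :
  cvert f' = idm (fob d0 (chor f)) -> cvert (@corner_comp f' f p) = cvert f.
Proof.
intros H.
assert (q : cod (cvert f) = dom (idm (cod (cvert f)))) by now rewrite dom_idm.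
assert (q' : cod (cvert f) = dom (fmor d1 (idm (chor f))))
  by (rewrite fmor_id, <- corner_eq; exact q).
rewrite (cvert_comp (a := idm (chor f)) p q').
- etransitivity; [|exact (comp_id_l q)]; apply comp_ext; trivial.
  now rewrite fmor_id, corner_eq.
- apply dom_idm.
- now rewrite fmor_id.
Qed.

Lemma chor_comp_id f' f p :
  cvert f' = idm (fob d0 (chor f)) ->
  forall q, chor (@corner_comp f' f p) = @hcomp_ob X (chor f) (chor f') q.
Proof.
intros H q.
assert (q' : fob d0 (cod (idm (chor f))) = fob d1 (chor f')) by now rewrite cod_idm.
rewrite (chor_comp (a := idm (chor f)) p q').
- apply hcomp_ob_ext; trivial; apply cod_idm.
- apply dom_idm.
- now rewrite fmor_id.
Qed.

Lemma corner_comp_hunit f' f p :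
  chor f = fob hunit (dom (cvert f')) ->
  chor (@corner_comp f' f p) = chor f' /\
  forall q, cvert (@corner_comp f' f p) = comp (cvert f') (cvert f) q.
Proof.
intros H.
assert (H1 : dom (fmor hunit (cvert f')) = chor f) by now rewrite dom_fmor.
assert (H2 : fmor d0 (fmor hunit (cvert f')) = cvert f') by apply d0um.
split.
- assert (q : fob d0 (fob hunit (cod (cvert f'))) = fob d1 (chor f'))
    by (rewrite d0u; apply corner_eq).
  assert (q' : fob d0 (cod (fmor hunit (cvert f'))) = fob d1 (chor f'))
    by (rewrite cod_fmor; exact q).
  rewrite (chor_comp p q' H1 H2); transitivity (hcomp_ob q).
  + apply hcomp_ob_ext; trivial; apply cod_fmor.
  + apply hunit_dom, corner_eq.
- intros q.
  assert (q' : cod (cvert f) = dom (fmor d1 (fmor hunit (cvert f'))))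
    by now rewrite d1um.
  rewrite (cvert_comp p q' H1 H2); apply comp_ext; trivial; apply d1um.
Qed.

Lemma corner_comp_assoc f3 f2 f1 p q p' q' :
  @corner_comp (@corner_comp f3 f2 q) f1 p' = @corner_comp f3 (@corner_comp f2 f1 p) q'.
Proof.
set (a := filler p); set (b := filler q).
assert (r : fob d0 (cod a) = dom (fmor d1 b)).
{ unfold a, b; rewrite <- cod_fmor, d0_filler, dom_fmor, dom_filler; apply corner_eq. }
pose (c := filler r).
assert (rac : cod a = dom c) by (symmetry; apply dom_filler).
assert (Hca : filler p' = comp c a rac).
{ apply filler_unique; [rewrite dom_comp; apply dom_filler|].
  assert (r' : cod (fmor d0 a) = dom (fmor d0 c)) by now rewrite cod_fmor, dom_fmor, rac.
  rewrite (fmor_comp d0 (q := r')); apply comp_ext; apply d0_filler. }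
assert (rcb : fmor d0 c = fmor d1 b) by apply d0_filler.
assert (Hcb : filler q' = hcomp_sq rcb).
{ apply filler_unique; [|rewrite d0hm; apply d0_filler].
  assert (r' : fob d0 (dom c) = fob d1 (dom b)) by now rewrite <- !dom_fmor, rcb.
  rewrite (dom_hcomp_sq rcb r'); apply hcomp_ob_ext; apply dom_filler. }
apply corner_ext.
- change (comp (fmor d1 (filler p')) (cvert f1) (left_filler_eq p' (corner_eq f1)) =
    comp (fmor d1 (filler q')) (comp (fmor d1 a) (cvert f1) (left_filler_eq p (corner_eq f1)))
      (left_filler_eq q' (corner_eq (corner_comp p)))).
  assert (r1 : cod (fmor d1 a) = dom (fmor d1 c)) by now rewrite cod_fmor, dom_fmor, rac.
  assert (r2 : cod (cvert f1) = dom (comp (fmor d1 c) (fmor d1 a) r1)).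
  { rewrite dom_comp; apply left_filler_eq, corner_eq. }
  assert (r3 : cod (comp (fmor d1 a) (cvert f1) (left_filler_eq p (corner_eq f1)))
               = dom (fmor d1 c)) by now rewrite cod_comp.
  transitivity (comp (comp (fmor d1 c) (fmor d1 a) r1) (cvert f1) r2).
  { apply comp_ext; trivial; rewrite Hca; apply fmor_comp. }
  etransitivity;
    [exact (comp_assoc (p := left_filler_eq p (corner_eq f1)) (q := r1) r2 r3)|].
  apply comp_ext; trivial; rewrite Hcb; symmetry; apply d1hm.
- change (hcomp_ob (bottom_filler_eq p' (corner_eq (corner_comp q))) =
          hcomp_ob (bottom_filler_eq q' (corner_eq f3))).
  assert (s1 : fob d0 (cod c) = fob d1 (cod b)) by now rewrite <- !cod_fmor, rcb.
  assert (s2 : fob d0 (cod b) = fob d1 (chor f3))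
    by apply bottom_filler_eq, corner_eq.
  assert (s3 : fob d0 (cod c) = fob d1 (hcomp_ob s2)) by now rewrite d1h.
  assert (s4 : fob d0 (hcomp_ob s1) = fob d1 (chor f3)) by now rewrite d0h.
  transitivity (hcomp_ob s3).
  { apply hcomp_ob_ext; [rewrite Hca; apply cod_comp | now apply hcomp_ob_ext]. }
  rewrite <- (hassoc (p := s1) s3 s4).
  apply hcomp_ob_ext; trivial.
  rewrite Hcb; symmetry; apply cod_hcomp_sq.
Qed.

Program Definition Cnr : SmallCat :=
  {| Ob := Ob (X0 X);
     Mor := Corner;
     dom := fun f => dom (cvert f);
     cod := fun f => fob d0 (chor f);
     idm := corner_id;
     comp := corner_comp |}.
Next Obligation. intros a; apply dom_idm. Qed.
Next Obligation. intros a; apply d0u. Qed.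
Next Obligation. intros; apply dom_comp. Qed.
Next Obligation. intros; apply d0h. Qed.
Next Obligation.
intros f p; destruct (@corner_comp_hunit f (corner_id (dom (cvert f))) p) as [H1 H2];
  [reflexivity|].
apply corner_ext; [|exact H1].
assert (q : cod (idm (dom (cvert f))) = dom (cvert f)) by apply cod_idm.
etransitivity; [exact (H2 q)|]; apply comp_id_r.
Qed.
Next Obligation.
intros f p; apply corner_ext; [now apply cvert_comp_id|].
assert (q : fob d0 (chor f) = fob d1 (fob hunit (fob d0 (chor f)))) by now rewrite d1u.
etransitivity; [exact (chor_comp_id p eq_refl q)|]; now apply hunit_cod.
Qed.
Next Obligation. exact corner_comp_assoc. Qed.

Definition Cnr_E (f : Mor Cnr) : Prop := chor f = fob hunit (cod (cvert f)).
Definition Cnr_M (f : Mor Cnr) : Prop := cvert f = idm (fob d1 (chor f)).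

Lemma Cnr_E_mid (f' f : Mor Cnr) : cod f = dom f' -> Cnr_E f ->
  cod (cvert f) = dom (cvert f') /\ chor f = fob hunit (dom (cvert f')).
Proof.
unfold Cnr_E; simpl; intros p Hf.
assert (H : cod (cvert f) = dom (cvert f')) by (rewrite <- p, Hf, d0u; reflexivity).
now rewrite <- H.
Qed.

Lemma Cnr_M_mid (f' f : Mor Cnr) : cod f = dom f' -> Cnr_M f' ->
  fob d0 (chor f) = fob d1 (chor f') /\ cvert f' = idm (fob d0 (chor f)).
Proof.
unfold Cnr_M; simpl; intros p Hf.
assert (H : fob d0 (chor f) = fob d1 (chor f')) by (rewrite p, Hf; apply dom_idm).
now rewrite H.
Qed.

Lemma Cnr_E_wide : wide_subcategory Cnr_E.
Proof.
split; unfold Cnr_E.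
- intros a; unfold chor, cvert; simpl; now rewrite cod_idm.
- intros g f p Hg Hf; destruct (Cnr_E_mid p Hf) as [q H].
  destruct (corner_comp_hunit p H) as [H1 H2]; simpl.
  now rewrite H1, (H2 q), cod_comp.
Qed.

Lemma Cnr_M_wide : wide_subcategory Cnr_M.
Proof.
split; unfold Cnr_M.
- intros a; unfold chor, cvert; simpl; now rewrite d1u.
- intros g f p Hg Hf; destruct (Cnr_M_mid p Hg) as [q H]; simpl.
  now rewrite (cvert_comp_id p H), (chor_comp_id p H q), d1h.
Qed.

Definition corner_u (u : Mor (X0 X)) : Corner :=
  exist _ (u, fob hunit (cod u)) (eq_sym (d1u (cod u))).
Definition corner_g (g : Ob (X1 X)) : Corner :=
  exist _ (idm (fob d1 g), g) (cod_idm (fob d1 g)).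

Lemma Cnr_comp_EM (e m : Mor Cnr) p : Cnr_E e -> Cnr_M m ->
  cvert (comp m e p) = cvert e /\ chor (comp m e p) = chor m.
Proof.
intros He Hm; split.
- apply (cvert_comp_id p), (Cnr_M_mid p Hm).
- apply (corner_comp_hunit p), (Cnr_E_mid p He).
Qed.

Program Definition Cnr_sfs : StrictFactSys :=
  {| sfs_cat := Cnr; sfs_E := Cnr_E; sfs_M := Cnr_M;
     sfs_E_wide := Cnr_E_wide; sfs_M_wide := Cnr_M_wide |}.
Next Obligation.
intros f.
assert (HE : Cnr_E (corner_u (cvert f))) by reflexivity.
assert (HM : Cnr_M (corner_g (chor f))) by reflexivity.
assert (p : cod (corner_u (cvert f) : Mor Cnr) = dom (corner_g (chor f) : Mor Cnr)).
{ change (fob d0 (fob hunit (cod (cvert f))) = dom (idm (fob d1 (chor f)))).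
  rewrite d0u, dom_idm; apply corner_eq. }
exists (corner_u (cvert f), corner_g (chor f)); split.
- simpl; split; [exact HE|split; [exact HM|]].
  exists p; destruct (Cnr_comp_EM p HE HM) as [H1 H2]; apply corner_ext; symmetry.
  + exact H1.
  + exact H2.
- intros [e m] [He [Hm [q Hq]]]; simpl fst in *; simpl snd in *.
  destruct (Cnr_comp_EM q He Hm) as [H1 H2]; rewrite <- Hq in H1, H2.
  f_equal; apply corner_ext.
  + exact H1.
  + rewrite He, <- H1; reflexivity.
  + rewrite Hm, <- H2; reflexivity.
  + exact H2.
Qed.

End Corners.

Section CornerFunctor.
Variables (X Y : DoubleCat) (HX : codomain_discrete X) (HY : codomain_discrete Y).
Variable F : DoubleFunctor X Y.

Lemma fmor_filler g u p q :
  fmor (df1 F) (@filler X HX g u p) = @filler Y HY (fob (df1 F) g) (fmor (df0 F) u) q.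
Proof.
symmetry; apply filler_unique; [now rewrite dom_fmor, dom_filler|].
now rewrite dfd0m, d0_filler.
Qed.

Lemma corner_map_eq (f : Corner X) :
  cod (fmor (df0 F) (cvert f)) = fob d1 (fob (df1 F) (chor f)).
Proof. now rewrite cod_fmor, dfd1, corner_eq. Qed.

Definition corner_map (f : Corner X) : Corner Y :=
  exist _ (fmor (df0 F) (cvert f), fob (df1 F) (chor f)) (corner_map_eq f).

Program Definition Cnr_fmor : SmallFunctor (Cnr HX) (Cnr HY) :=
  {| fob := fun a : Ob (Cnr HX) => fob (df0 F) a : Ob (Cnr HY);
     fmor := fun f : Mor (Cnr HX) => corner_map f : Mor (Cnr HY) |}.
Next Obligation. intros f; exact (dom_fmor (df0 F) (cvert f)). Qed.
Next Obligation. intros f; exact (dfd0 F (chor f)). Qed.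
Next Obligation.
intros a; apply corner_ext; unfold cvert, chor; simpl; [apply fmor_id | apply dfu].
Qed.
Next Obligation.
intros g f p q; simpl in p, q; apply corner_ext.
- assert (r : cod (fmor (df0 F) (cvert f)) =
              dom (fmor (df0 F) (fmor d1 (filler HX p)))).
  { rewrite cod_fmor, dom_fmor; f_equal; apply left_filler_eq, corner_eq. }
  etransitivity; [exact (fmor_comp (df0 F) (q := r))|]; apply comp_ext; trivial.
  rewrite <- dfd1m; f_equal; apply fmor_filler.
- assert (r : fob d0 (fob (df1 F) (cod (filler HX p))) = fob d1 (fob (df1 F) (chor g))).
  { rewrite dfd0, dfd1; f_equal; apply bottom_filler_eq, corner_eq. }
  etransitivity; [exact (dfh (bottom_filler_eq HX p (corner_eq g)) r)|].
  apply hcomp_ob_ext; trivial.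
  rewrite <- cod_fmor; f_equal; apply fmor_filler.
Qed.

Program Definition Cnr_sfsf : SFSFunctor (Cnr_sfs HX) (Cnr_sfs HY) :=
  {| sfs_functor := Cnr_fmor |}.
Next Obligation.
intros f Hf; hnf in Hf; hnf.
change (fob (df1 F) (chor f) = fob hunit (cod (fmor (df0 F) (cvert f)))).
now rewrite Hf, dfu, cod_fmor.
Qed.
Next Obligation.
intros f Hf; hnf in Hf; hnf.
change (fmor (df0 F) (cvert f) = idm (fob d1 (fob (df1 F) (chor f)))).
now rewrite Hf, fmor_id, dfd1.
Qed.
End CornerFunctor.

Program Definition CnrFunctor : Functor CodDiscr SFS :=
  {| FOb := fun X : Obj CodDiscr => Cnr_sfs (proj2_sig X) : Obj SFS;
     FHom := fun (X Y : Obj CodDiscr) (F : Hom CodDiscr X Y) =>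
       Cnr_sfsf (proj2_sig X) (proj2_sig Y) F |}.
Next Obligation.
intros X; apply sfsf_ext, sf_ext; [reflexivity|intros f; now apply corner_ext].
Qed.
Next Obligation.
intros X Y Z G F; apply sfsf_ext, sf_ext; [reflexivity|intros f; now apply corner_ext].
Qed.

Section DoubleOfSFS.
Variable S : StrictFactSys.

Lemma E_id (a : Ob S) : sfs_E (idm a).
Proof. apply sfs_E_wide. Qed.
Lemma E_comp (g f : Mor S) p : sfs_E g -> sfs_E f -> sfs_E (comp g f p).
Proof. apply sfs_E_wide. Qed.
Lemma M_id (a : Ob S) : sfs_M (idm a).
Proof. apply sfs_M_wide. Qed.
Lemma M_comp (g f : Mor S) p : sfs_M g -> sfs_M f -> sfs_M (comp g f p).
Proof. apply sfs_M_wide. Qed.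

Definition EMor := {f : Mor S | sfs_E f}.
Definition MMor := {f : Mor S | sfs_M f}.

Definition compE (g f : EMor) (p : cod (proj1_sig f) = dom (proj1_sig g)) : EMor :=
  exist _ (comp (proj1_sig g) (proj1_sig f) p) (E_comp p (proj2_sig g) (proj2_sig f)).
Definition compM (g f : MMor) (p : cod (proj1_sig f) = dom (proj1_sig g)) : MMor :=
  exist _ (comp (proj1_sig g) (proj1_sig f) p) (M_comp p (proj2_sig g) (proj2_sig f)).
Definition idE (a : Ob S) : EMor := exist _ (idm a) (E_id a).
Definition idM (a : Ob S) : MMor := exist _ (idm a) (M_id a).

Program Definition D_X0 : SmallCat :=
  {| Ob := Ob S; Mor := EMor;
     dom := fun f => dom (proj1_sig f);
     cod := fun f => cod (proj1_sig f);
     idm := idE;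
     comp := compE |}.
Next Obligation. intros; apply dom_idm. Qed.
Next Obligation. intros; apply cod_idm. Qed.
Next Obligation. intros; apply dom_comp. Qed.
Next Obligation. intros; apply cod_comp. Qed.
Next Obligation. intros; apply sig_ext, comp_id_r. Qed.
Next Obligation. intros; apply sig_ext, comp_id_l. Qed.
Next Obligation. intros; apply sig_ext, comp_assoc. Qed.

(** That the left edge starts where the top edge does, and the right edge ends
    where the bottom edge does, follows from [sq_comm]. *)
Record CommSquare := {
  sq_top : MMor;
  sq_bot : MMor;
  sq_left : EMor;
  sq_right : EMor;
  sq_tr : cod (proj1_sig sq_top) = dom (proj1_sig sq_right);
  sq_lb : cod (proj1_sig sq_left) = dom (proj1_sig sq_bot);
  sq_comm : comp (proj1_sig sq_right) (proj1_sig sq_top) sq_tr =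
            comp (proj1_sig sq_bot) (proj1_sig sq_left) sq_lb
}.

Lemma sq_ext (a b : CommSquare) :
  sq_top a = sq_top b -> sq_bot a = sq_bot b ->
  sq_left a = sq_left b -> sq_right a = sq_right b -> a = b.
Proof.
destruct a as [t1 b1 l1 r1 p1 q1 c1], b as [t2 b2 l2 r2 p2 q2 c2]; simpl.
intros; subst.
assert (p1 = p2) by apply proof_irrelevance; subst.
assert (q1 = q2) by apply proof_irrelevance; subst.
f_equal; apply proof_irrelevance.
Qed.

Lemma sq_tl (a : CommSquare) : dom (proj1_sig (sq_left a)) = dom (proj1_sig (sq_top a)).
Proof. now rewrite <- (dom_comp (sq_tr a)), <- (dom_comp (sq_lb a)), sq_comm. Qed.
Lemma sq_br (a : CommSquare) : cod (proj1_sig (sq_right a)) = cod (proj1_sig (sq_bot a)).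
Proof. now rewrite <- (cod_comp (sq_tr a)), <- (cod_comp (sq_lb a)), sq_comm. Qed.

Program Definition sq_vid (m : MMor) : CommSquare :=
  {| sq_top := m; sq_bot := m;
     sq_left := idE (dom (proj1_sig m)); sq_right := idE (cod (proj1_sig m)) |}.
Next Obligation. intros; simpl; now rewrite dom_idm. Qed.
Next Obligation. intros; simpl; now rewrite cod_idm. Qed.
Next Obligation. intros; simpl; now rewrite comp_id_l, comp_id_r. Qed.

Program Definition sq_hid (e : EMor) : CommSquare :=
  {| sq_top := idM (dom (proj1_sig e)); sq_bot := idM (cod (proj1_sig e));
     sq_left := e; sq_right := e |}.
Next Obligation. intros; simpl; now rewrite cod_idm. Qed.
Next Obligation. intros; simpl; now rewrite dom_idm. Qed.
Next Obligation. intros; simpl; now rewrite comp_id_l, comp_id_r. Qed.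

Lemma vcomp_eqL (b a : CommSquare) (p : sq_bot a = sq_top b) :
  cod (proj1_sig (sq_left a)) = dom (proj1_sig (sq_left b)).
Proof. now rewrite sq_lb, sq_tl, p. Qed.
Lemma vcomp_eqR (b a : CommSquare) (p : sq_bot a = sq_top b) :
  cod (proj1_sig (sq_right a)) = dom (proj1_sig (sq_right b)).
Proof. now rewrite <- sq_tr, sq_br, p. Qed.
Lemma hcomp_eqT (a b : CommSquare) (p : sq_right a = sq_left b) :
  cod (proj1_sig (sq_top a)) = dom (proj1_sig (sq_top b)).
Proof. now rewrite sq_tr, <- sq_tl, p. Qed.
Lemma hcomp_eqB (a b : CommSquare) (p : sq_right a = sq_left b) :
  cod (proj1_sig (sq_bot a)) = dom (proj1_sig (sq_bot b)).
Proof. now rewrite <- sq_lb, <- sq_br, p. Qed.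

Lemma paste (t1 t2 l m r b1 b2 : Mor S)
  (p1 : cod t1 = dom m) (q1 : cod l = dom b1)
  (p2 : cod t2 = dom r) (q2 : cod m = dom b2)
  (c1 : comp m t1 p1 = comp b1 l q1) (c2 : comp r t2 p2 = comp b2 m q2)
  (e1 : cod t1 = dom t2) (e2 : cod b1 = dom b2) p q :
  comp r (comp t2 t1 e1) p = comp (comp b2 b1 e2) l q.
Proof.
assert (x1 : cod t1 = dom (comp r t2 p2)) by now rewrite dom_comp.
rewrite <- (comp_assoc (p := e1) (q := p2) x1 p).
assert (x2 : cod (comp b1 l q1) = dom b2) by now rewrite cod_comp.
rewrite (comp_assoc (p := q1) (q := e2) q x2).
assert (x3 : cod t1 = dom (comp b2 m q2)) by now rewrite dom_comp.
transitivity (comp (comp b2 m q2) t1 x3); [now apply comp_ext|].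
assert (x4 : cod (comp m t1 p1) = dom b2) by now rewrite cod_comp.
rewrite (comp_assoc (p := p1) (q := q2) x3 x4); now apply comp_ext.
Qed.

Program Definition sq_vcomp (b a : CommSquare) (p : sq_bot a = sq_top b) : CommSquare :=
  {| sq_top := sq_top a; sq_bot := sq_bot b;
     sq_left := compE (vcomp_eqL p); sq_right := compE (vcomp_eqR p) |}.
Next Obligation. intros b a p; simpl; rewrite dom_comp; apply sq_tr. Qed.
Next Obligation. intros b a p; simpl; rewrite cod_comp; apply sq_lb. Qed.
Next Obligation.
intros b a p; simpl; symmetry.
assert (q2 : cod (proj1_sig (sq_bot a)) = dom (proj1_sig (sq_right b)))
  by (rewrite p; apply sq_tr).
apply paste with (m := proj1_sig (sq_bot a)) (p1 := sq_lb a) (q1 := sq_tr a)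
                 (p2 := sq_lb b) (q2 := q2).
- symmetry; apply sq_comm.
- rewrite <- sq_comm; apply comp_ext; now rewrite ?p.
Qed.

Program Definition sq_hcomp (a b : CommSquare) (p : sq_right a = sq_left b) : CommSquare :=
  {| sq_top := compM (hcomp_eqT p); sq_bot := compM (hcomp_eqB p);
     sq_left := sq_left a; sq_right := sq_right b |}.
Next Obligation. intros b a p; simpl; rewrite cod_comp; apply sq_tr. Qed.
Next Obligation. intros b a p; simpl; rewrite dom_comp; apply sq_lb. Qed.
Next Obligation.
intros a b p; simpl.
assert (q2 : cod (proj1_sig (sq_right a)) = dom (proj1_sig (sq_bot b)))
  by (rewrite p; apply sq_lb).
apply paste with (m := proj1_sig (sq_right a)) (p1 := sq_tr a) (q1 := sq_lb a)
                 (p2 := sq_tr b) (q2 := q2).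
- apply sq_comm.
- rewrite sq_comm; apply comp_ext; now rewrite ?p.
Qed.

Program Definition D_X1 : SmallCat :=
  {| Ob := MMor; Mor := CommSquare;
     dom := sq_top; cod := sq_bot;
     idm := sq_vid; comp := sq_vcomp |}.
Next Obligation. reflexivity. Qed.
Next Obligation. reflexivity. Qed.
Next Obligation. reflexivity. Qed.
Next Obligation. reflexivity. Qed.
Next Obligation.
intros a p; apply sq_ext; trivial; apply sig_ext; simpl.
- etransitivity; [|apply comp_id_r]; apply comp_ext; trivial; simpl; now rewrite sq_tl.
  Unshelve. now rewrite cod_idm.
- etransitivity; [|apply comp_id_r]; apply comp_ext; trivial; simpl; now rewrite sq_tr.
  Unshelve. now rewrite cod_idm.
Qed.
Next Obligation.
intros a p; apply sq_ext; trivial; apply sig_ext; simpl.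
- etransitivity; [|apply comp_id_l]; apply comp_ext; trivial; simpl; now rewrite sq_lb.
  Unshelve. now rewrite dom_idm.
- etransitivity; [|apply comp_id_l]; apply comp_ext; trivial; simpl; now rewrite sq_br.
  Unshelve. now rewrite dom_idm.
Qed.
Next Obligation.
intros; apply sq_ext; trivial; apply sig_ext, comp_assoc.
Qed.

Program Definition D_d0 : SmallFunctor D_X1 D_X0 :=
  {| fob := fun m : Ob D_X1 => cod (proj1_sig m) : Ob D_X0;
     fmor := fun a : Mor D_X1 => sq_right a : Mor D_X0 |}.
Next Obligation. intros; symmetry; apply sq_tr. Qed.
Next Obligation. intros; apply sq_br. Qed.
Next Obligation. reflexivity. Qed.
Next Obligation. intros; apply sig_ext; now apply comp_ext. Qed.

Program Definition D_d1 : SmallFunctor D_X1 D_X0 :=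
  {| fob := fun m : Ob D_X1 => dom (proj1_sig m) : Ob D_X0;
     fmor := fun a : Mor D_X1 => sq_left a : Mor D_X0 |}.
Next Obligation. intros; apply sq_tl. Qed.
Next Obligation. intros; apply sq_lb. Qed.
Next Obligation. reflexivity. Qed.
Next Obligation. intros; apply sig_ext; now apply comp_ext. Qed.

Program Definition D_hunit : SmallFunctor D_X0 D_X1 :=
  {| fob := fun a : Ob D_X0 => idM a : Ob D_X1;
     fmor := fun e : Mor D_X0 => sq_hid e : Mor D_X1 |}.
Next Obligation. reflexivity. Qed.
Next Obligation. reflexivity. Qed.
Next Obligation.
intros a; apply sq_ext; simpl; trivial; try apply sig_ext; simpl;
  now rewrite ?dom_idm, ?cod_idm.
Qed.
Next Obligation.
intros; apply sq_ext; try apply sig_ext; simpl; try now apply comp_ext.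
- now rewrite dom_comp.
- now rewrite cod_comp.
Qed.

Program Definition D_hcomp : SmallFunctor (Pullback D_d0 D_d1) D_X1 :=
  {| fob := fun x : Ob (Pullback D_d0 D_d1) => compM (proj2_sig x) : Ob D_X1;
     fmor := fun a : Mor (Pullback D_d0 D_d1) => sq_hcomp (proj2_sig a) : Mor D_X1 |}.
Next Obligation. intros; apply sig_ext; now apply comp_ext. Qed.
Next Obligation. intros; apply sig_ext; now apply comp_ext. Qed.
Next Obligation.
intros; apply sq_ext; try apply sig_ext; simpl; try now apply comp_ext.
- now rewrite dom_comp.
- now rewrite cod_comp.
Qed.
Next Obligation.
intros; apply sq_ext; try apply sig_ext; simpl; now apply comp_ext.
Qed.

Program Definition D_double : DoubleCat :=
  {| X0 := D_X0; X1 := D_X1; d0 := D_d0; d1 := D_d1;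
     hunit := D_hunit; hcomp := D_hcomp |}.
Next Obligation. apply sf_ext; simpl; trivial; apply cod_idm. Qed.
Next Obligation. apply sf_ext; simpl; trivial; apply dom_idm. Qed.
Next Obligation. apply sf_ext; simpl; trivial; intros; apply cod_comp. Qed.
Next Obligation. apply sf_ext; simpl; trivial; intros; apply dom_comp. Qed.
Next Obligation.
intros e; apply sf_ext; intros a.
- apply sig_ext, comp_id_r.
- apply sq_ext; simpl; trivial; apply sig_ext; simpl.
  + etransitivity; [|apply comp_id_r]; apply comp_ext; trivial; simpl; now rewrite sq_tl.
    Unshelve. now rewrite cod_idm.
  + etransitivity; [|apply comp_id_r]; apply comp_ext; trivial; simpl; now rewrite sq_lb.
    Unshelve. now rewrite cod_idm.
Qed.
Next Obligation.
intros e; apply sf_ext; intros a.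
- apply sig_ext, comp_id_l.
- apply sq_ext; simpl; trivial; apply sig_ext; simpl.
  + etransitivity; [|apply comp_id_l]; apply comp_ext; trivial; simpl; now rewrite sq_tr.
    Unshelve. now rewrite dom_idm.
  + etransitivity; [|apply comp_id_l]; apply comp_ext; trivial; simpl; now rewrite sq_br.
    Unshelve. now rewrite dom_idm.
Qed.
Next Obligation.
intros X2 X3 p12 p1 p2 p3 e e' e''; apply sf_ext; intros [[[[f g] E1] h] E2].
- apply sig_ext; symmetry; apply comp_assoc.
- apply sq_ext; simpl; trivial; apply sig_ext; symmetry; apply comp_assoc.
Qed.

Lemma D_codomain_discrete : codomain_discrete D_double.
Proof.
intros m e p; simpl in m, e, p.
destruct (sfs_fact (comp (proj1_sig e) (proj1_sig m) p)) as [[l b] [[Hl [Hb [q Hq]]] U]].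
simpl in *.
exists (@Build_CommSquare m (exist _ b Hb) (exist _ l Hl) e p q Hq); split; [now split|].
intros a [Ht Hr]; simpl in *; subst m e.
assert (E : (l, b) = (proj1_sig (sq_left a), proj1_sig (sq_bot a))).
{ apply U; simpl; split; [apply proj2_sig|split; [apply proj2_sig|]].
  exists (sq_lb a); rewrite <- sq_comm; now apply comp_ext. }
injection E as E1 E2.
apply sq_ext; simpl; trivial; now apply sig_ext.
Qed.

End DoubleOfSFS.

Section DoubleOfSFSFunctor.
Variables (S T : StrictFactSys) (F : SFSFunctor S T).

Definition mapE (f : EMor S) : EMor T :=
  exist _ (fmor F (proj1_sig f)) (sfs_functor_E F (proj2_sig f)).
Definition mapM (f : MMor S) : MMor T :=
  exist _ (fmor F (proj1_sig f)) (sfs_functor_M F (proj2_sig f)).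

Program Definition mapSq (a : CommSquare S) : CommSquare T :=
  {| sq_top := mapM (sq_top a); sq_bot := mapM (sq_bot a);
     sq_left := mapE (sq_left a); sq_right := mapE (sq_right a) |}.
Next Obligation. intros a; simpl; now rewrite cod_fmor, dom_fmor, sq_tr. Qed.
Next Obligation. intros a; simpl; now rewrite cod_fmor, dom_fmor, sq_lb. Qed.
Next Obligation.
intros a; simpl; rewrite <- (fmor_comp F (p := sq_tr a)), sq_comm; apply fmor_comp.
Qed.

Program Definition D_df0 : SmallFunctor (D_X0 S) (D_X0 T) :=
  {| fob := fun a : Ob (D_X0 S) => fob F a : Ob (D_X0 T);
     fmor := fun e : Mor (D_X0 S) => mapE e : Mor (D_X0 T) |}.
Next Obligation. intros f; exact (dom_fmor F (proj1_sig f)). Qed.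
Next Obligation. intros f; exact (cod_fmor F (proj1_sig f)). Qed.
Next Obligation. intros a; apply sig_ext; exact (fmor_id F a). Qed.
Next Obligation. intros g f p q; apply sig_ext; exact (fmor_comp F (p := p) (q := q)). Qed.

Program Definition D_df1 : SmallFunctor (D_X1 S) (D_X1 T) :=
  {| fob := fun m : Ob (D_X1 S) => mapM m : Ob (D_X1 T);
     fmor := fun a : Mor (D_X1 S) => mapSq a : Mor (D_X1 T) |}.
Next Obligation. reflexivity. Qed.
Next Obligation. reflexivity. Qed.
Next Obligation.
intros; apply sq_ext; trivial; apply sig_ext; simpl;
  now rewrite fmor_id, ?dom_fmor, ?cod_fmor.
Qed.
Next Obligation. intros; apply sq_ext; trivial; apply sig_ext, fmor_comp. Qed.

Program Definition D_df : DoubleFunctor (D_double S) (D_double T) :=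
  {| df0 := D_df0; df1 := D_df1 |}.
Next Obligation. apply sf_ext; trivial; intros f; exact (cod_fmor F (proj1_sig f)). Qed.
Next Obligation. apply sf_ext; trivial; intros f; exact (dom_fmor F (proj1_sig f)). Qed.
Next Obligation.
apply sf_ext; intros; [apply sig_ext, fmor_id|].
apply sq_ext; trivial; apply sig_ext; simpl; now rewrite fmor_id, ?dom_fmor, ?cod_fmor.
Qed.
Next Obligation.
intros e; apply sf_ext; intros; [apply sig_ext, fmor_comp|].
apply sq_ext; trivial; apply sig_ext, fmor_comp.
Qed.
End DoubleOfSFSFunctor.

Program Definition DFunctor : Functor SFS CodDiscr :=
  {| FOb := fun S : Obj SFS =>
       exist codomain_discrete (D_double S) (@D_codomain_discrete S) : Obj CodDiscr;
     FHom := fun S T (F : Hom SFS S T) => D_df F |}.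
Next Obligation.
intros S; apply df_ext; apply sf_ext; simpl; trivial; intros f;
  try apply sq_ext; now apply sig_ext.
Qed.
Next Obligation.
intros S T U G F; apply df_ext; apply sf_ext; simpl; trivial; intros f;
  try apply sq_ext; now apply sig_ext.
Qed.

(* Main.v *)
Require Import Defs.
From Stdlib Require Import ClassicalEpsilon.

(** A square of a codomain-discrete double category is determined by its top
    and right edges, and its left and bottom edges are the two components of the
    corner [[u, 1] ∘ [1, g]].  Hence squares correspond to the commutative squares
    of the category of corners, which gives [X ≅ D (Cnr X)].  In the other
    direction, [[e, m] ↦ m ∘ e] is bijective on morphisms by the existence and
    uniqueness of factorizations. *)

Set Implicit Arguments.
Unset Strict Implicit.
Unset Printing Implicit Defensive.
Local Obligation Tactic := idtac.

(** * Natural isomorphisms *)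

(** The components of the inverse are picked by indefinite description, so later proofs only have to
    show that each component is invertible. *)
Lemma NatIsomorphic_pointwise (A B : Category) (F G : Functor A B)
  (t : forall a, Hom B (F a) (G a)) :
  (forall a b (f : Hom A a b), Comp (t b) (FHom F f) = Comp (FHom G f) (t a)) ->
  (forall a, exists s : Hom B (G a) (F a), Comp s (t a) = Id (F a) /\ Comp (t a) s = Id (G a)) ->
  NatIsomorphic F G.
Proof.
intros nat iso.
pose (s a := constructive_indefinite_description _ (iso a)).
constructor; exists t (fun a => proj1_sig (s a)); trivial;
  intros a; apply (proj2_sig (s a)).
Qed.

(** Composing the naturality square of [t] with the inverse components on both sides gives that of
    [s]. *)
Lemma NatIsomorphic_sym (A B : Category) (F G : Functor A B) :
  NatIsomorphic F G -> NatIsomorphic G F.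
Proof.
intros [[t s nat st ts]]; constructor; exists s t; trivial.
intros a b f.
rewrite <- (Comp_id_r (Comp (s b) (FHom G f))), <- ts, Comp_assoc,
  <- (Comp_assoc (FHom G f)), <- nat.
now rewrite <- !Comp_assoc, st, Comp_id_l.
Qed.

(** * Inverting functors that are bijective on objects and morphisms *)

Definition bijective (A B : Type) (f : A -> B) : Prop :=
  (forall x y, f x = f y -> x = y) /\ (forall y, exists x, f x = y).

Lemma bijective_inverse (A B : Type) (f : A -> B) :
  bijective f -> exists g, (forall x, g (f x) = x) /\ (forall y, f (g y) = y).
Proof.
intros [inj surj].
pose (g y := constructive_indefinite_description _ (surj y)).
assert (fg : forall y, f (proj1_sig (g y)) = y) by (intros y; exact (proj2_sig (g y))).
exists (fun y => proj1_sig (g y)); split; [intros x; now apply inj | exact fg].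
Qed.

Lemma bijective_id (A : Type) : bijective (fun x : A => x).
Proof. split; [trivial | intros y; now exists y]. Qed.

(** Each functor law for the inverse functions becomes a law of [F] after [F] is applied, and [F] is
    injective. *)
Lemma small_functor_inverse (C D : SmallCat) (F : SmallFunctor C D) :
  bijective (fob F) -> bijective (fmor F) ->
  exists G : SmallFunctor D C, sf_comp G F = sf_id C /\ sf_comp F G = sf_id D.
Proof.
intros b0 b1.
destruct (bijective_inverse b0) as [g0 [gf0 fg0]], (bijective_inverse b1) as [g1 [gf1 fg1]].
destruct b0 as [i0 _], b1 as [i1 _].
unshelve eexists {| fob := g0; fmor := g1 |}.
- intros f; apply i0; now rewrite <- dom_fmor, fg0, fg1.
- intros f; apply i0; now rewrite <- cod_fmor, fg0, fg1.
- intros a; apply i1; now rewrite fmor_id, fg0, fg1.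
- intros g f p q; apply i1.
  assert (r : cod (fmor F (g1 f)) = dom (fmor F (g1 g))) by now rewrite !fg1.
  rewrite fg1, (fmor_comp F (q := r)); apply comp_ext; now rewrite fg1.
- split; now apply sf_ext.
Qed.

(** The functors on [X0] and [X1] are inverted separately. Compatibility of the inverses with [d0],
    [d1], [hunit] and [hcomp] then follows from that of [F], by injectivity. *)
Lemma double_functor_inverse (X Y : DoubleCat) (F : DoubleFunctor X Y) :
  bijective (fob (df0 F)) -> bijective (fmor (df0 F)) ->
  bijective (fob (df1 F)) -> bijective (fmor (df1 F)) ->
  exists G : DoubleFunctor Y X, df_comp G F = df_id X /\ df_comp F G = df_id Y.
Proof.
intros b00 b01 b10 b11.
destruct (small_functor_inverse b00 b01) as [G0 [GF0 FG0]].
destruct (small_functor_inverse b10 b11) as [G1 [GF1 FG1]].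
assert (o0 : forall x, fob (df0 F) (fob G0 x) = x)
  by (intros x; exact (f_equal (fun S => fob S x) FG0)).
assert (m0 : forall x, fmor (df0 F) (fmor G0 x) = x)
  by (intros x; exact (f_equal (fun S => fmor S x) FG0)).
assert (o1 : forall x, fob (df1 F) (fob G1 x) = x)
  by (intros x; exact (f_equal (fun S => fob S x) FG1)).
assert (m1 : forall x, fmor (df1 F) (fmor G1 x) = x)
  by (intros x; exact (f_equal (fun S => fmor S x) FG1)).
destruct b00 as [i00 _], b01 as [i01 _], b10 as [i10 _], b11 as [i11 _].
unshelve eexists {| df0 := G0; df1 := G1 |}.
- apply sf_ext; intros x; simpl.
  + apply i00; now rewrite <- dfd0, o0, o1.
  + apply i01; now rewrite <- dfd0m, m0, m1.
- apply sf_ext; intros x; simpl.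
  + apply i00; now rewrite <- dfd1, o0, o1.
  + apply i01; now rewrite <- dfd1m, m0, m1.
- apply sf_ext; intros x; simpl.
  + apply i10; now rewrite dfu, o0, o1.
  + apply i11; now rewrite dfum, m0, m1.
- intros e; apply sf_ext; intros [[a b] p]; simpl in *.
  + apply i10; rewrite o1.
    assert (q : fob d0 (fob G1 a) = fob d1 (fob G1 b))
      by (apply i00; now rewrite <- dfd0, <- dfd1, !o1).
    assert (r : fob d0 (fob (df1 F) (fob G1 a)) = fob d1 (fob (df1 F) (fob G1 b)))
      by now rewrite !o1.
    (* The intermediate term is the image under [F] of the composite of the two preimages, to which
       preservation of [hcomp] by [F] applies. *)
    transitivity (fob (df1 F) (hcomp_ob q)).
    * rewrite (dfh q r); apply (@hcomp_ob_ext Y a _ b _ p); now rewrite o1.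
    * f_equal; now apply hcomp_ob_ext.
  + apply i11; rewrite m1.
    assert (q : fmor d0 (fmor G1 a) = fmor d1 (fmor G1 b))
      by (apply i01; now rewrite <- dfd0m, <- dfd1m, !m1).
    assert (r : fmor d0 (fmor (df1 F) (fmor G1 a)) = fmor d1 (fmor (df1 F) (fmor G1 b)))
      by now rewrite !m1.
    transitivity (fmor (df1 F) (hcomp_sq q)).
    * rewrite (dfhm q r); apply (@hcomp_sq_ext Y a _ b _ p); now rewrite m1.
    * f_equal; now apply hcomp_sq_ext.
- split; now apply df_ext.
Qed.

(** Reflection of the two classes by [F] is their preservation by the inverse. *)
Lemma sfs_functor_inverse (S T : StrictFactSys) (F : SFSFunctor S T) :
  bijective (fob F) -> bijective (fmor F) ->
  (forall f, sfs_E (fmor F f) -> sfs_E f) -> (forall f, sfs_M (fmor F f) -> sfs_M f) ->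
  exists G : SFSFunctor T S, sfsf_comp G F = sfsf_id S /\ sfsf_comp F G = sfsf_id T.
Proof.
intros b0 b1 rE rM.
destruct (small_functor_inverse b0 b1) as [G [GF FG]].
assert (m : forall f, fmor F (fmor G f) = f)
  by (intros f; exact (f_equal (fun S => fmor S f) FG)).
unshelve eexists {| sfs_functor := G |}.
- intros f Hf; apply rE; now rewrite m.
- intros f Hf; apply rM; now rewrite m.
- split; now apply sfsf_ext.
Qed.

(** * The comparison double functor from [X] to [D (Cnr X)] *)

Section Unit.
Variables (X : DoubleCat) (HX : codomain_discrete X).
Local Notation C := (Cnr HX).

Lemma corner_u_E (u : Mor (X0 X)) : Cnr_E (HX := HX) (corner_u u).
Proof. reflexivity. Qed.
Lemma corner_g_M (g : Ob (X1 X)) : Cnr_M (HX := HX) (corner_g g).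
Proof. reflexivity. Qed.

Lemma cod_corner_u (u : Mor (X0 X)) : cod (corner_u u : Mor C) = cod u.
Proof. exact (d0u (cod u)). Qed.
Lemma dom_corner_g (g : Ob (X1 X)) : dom (corner_g g : Mor C) = fob d1 g.
Proof. exact (dom_idm (fob d1 g)). Qed.

Lemma corner_u_idm (a : Ob (X0 X)) : corner_u (idm a) = corner_id a.
Proof. apply corner_ext; unfold cvert, chor; simpl; now rewrite ?cod_idm. Qed.
Lemma corner_g_hunit (a : Ob (X0 X)) : corner_g (fob hunit a) = corner_id a.
Proof. apply corner_ext; unfold cvert, chor; simpl; now rewrite ?d1u. Qed.

(** The middle horizontal edge is an identity, so the filler is the horizontal identity square on
    [v]. *)
Lemma corner_u_comp (v u : Mor (X0 X)) p q :
  (corner_u (comp v u p) : Mor C) = comp (corner_u v : Mor C) (corner_u u : Mor C) q.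
Proof.
destruct (@corner_comp_hunit X HX (corner_u v) (corner_u u) q) as [H1 H2].
{ unfold cvert, chor; simpl; now rewrite p. }
symmetry; apply corner_ext.
- exact (H2 p).
- etransitivity; [exact H1|]; unfold chor; simpl; now rewrite cod_comp.
Qed.

(** The middle vertical edge is an identity, so the filler is the vertical identity square on
    [g]. *)
Lemma corner_g_hcomp (g h : Ob (X1 X)) p q :
  (corner_g (@hcomp_ob X g h p) : Mor C) = comp (corner_g h : Mor C) (corner_g g : Mor C) q.
Proof.
assert (H : cvert (corner_g h) = idm (fob d0 (chor (corner_g g))))
  by (unfold cvert, chor; simpl; now rewrite p).
symmetry; apply corner_ext.
- etransitivity; [exact (cvert_comp_id HX q H)|]; unfold cvert; simpl; now rewrite d1h.
- exact (chor_comp_id HX q H p).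
Qed.

(** Both sides are the corner [[d1 a, cod a]]. On the left, [a] itself is the filler of its top and
    right edges; on the right, a vertical corner followed by a horizontal one just juxtaposes the
    two components. *)
Lemma corner_square_comm (a : Mor (X1 X)) p q :
  comp (corner_u (fmor d0 a) : Mor C) (corner_g (dom a) : Mor C) p =
  comp (corner_g (cod a) : Mor C) (corner_u (fmor d1 a) : Mor C) q.
Proof.
destruct (Cnr_comp_EM q (corner_u_E _) (corner_g_M _)) as [H1 H2].
apply corner_ext; rewrite ?H1, ?H2.
- assert (r : cod (idm (fob d1 (dom a))) = dom (fmor d1 a)) by now rewrite cod_idm, dom_fmor.
  etransitivity.
  + apply (cvert_comp HX (f' := corner_u (fmor d0 a)) (f := corner_g (dom a)) p r); reflexivity.
  + assert (r' : cod (idm (dom (fmor d1 a))) = dom (fmor d1 a)) by apply cod_idm.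
    etransitivity; [|exact (comp_id_r r')]; apply comp_ext; trivial.
    unfold cvert; simpl; now rewrite dom_fmor.
- assert (r : fob d0 (cod a) = fob d1 (fob hunit (cod (fmor d0 a))))
    by now rewrite d1u, cod_fmor.
  etransitivity.
  + apply (chor_comp HX (f' := corner_u (fmor d0 a)) (f := corner_g (dom a)) p r); reflexivity.
  + apply hunit_cod, cod_fmor.
Qed.

Definition unitE (u : Mor (X0 X)) : EMor (Cnr_sfs HX) := exist _ _ (corner_u_E u).
Definition unitM (g : Ob (X1 X)) : MMor (Cnr_sfs HX) := exist _ _ (corner_g_M g).

Program Definition unit_sq (a : Mor (X1 X)) : CommSquare (Cnr_sfs HX) :=
  {| sq_top := unitM (dom a); sq_bot := unitM (cod a);
     sq_left := unitE (fmor d1 a); sq_right := unitE (fmor d0 a) |}.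
Next Obligation. intros a; exact (eq_sym (dom_fmor d0 a)). Qed.
Next Obligation.
intros a; refine (eq_trans (cod_corner_u _) (eq_trans _ (eq_sym (dom_corner_g _)))).
exact (cod_fmor d1 a).
Qed.
Next Obligation. intros a; apply corner_square_comm. Qed.

Program Definition unit_df0 : SmallFunctor (X0 X) (D_X0 (Cnr_sfs HX)) :=
  {| fob := fun a => a : Ob (D_X0 (Cnr_sfs HX));
     fmor := fun u => unitE u : Mor (D_X0 (Cnr_sfs HX)) |}.
Next Obligation. reflexivity. Qed.
Next Obligation. exact cod_corner_u. Qed.
Next Obligation. intros a; apply sig_ext; exact (corner_u_idm a). Qed.
Next Obligation. intros g f p q; apply sig_ext; exact (corner_u_comp p q). Qed.

Program Definition unit_df1 : SmallFunctor (X1 X) (D_X1 (Cnr_sfs HX)) :=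
  {| fob := fun g => unitM g : Ob (D_X1 (Cnr_sfs HX));
     fmor := fun a => unit_sq a : Mor (D_X1 (Cnr_sfs HX)) |}.
Next Obligation. reflexivity. Qed.
Next Obligation. reflexivity. Qed.
Next Obligation.
intros g; apply sq_ext; apply sig_ext.
- exact (f_equal (@corner_g X) (dom_idm g)).
- exact (f_equal (@corner_g X) (cod_idm g)).
- etransitivity; [exact (f_equal (@corner_u X) (fmor_id d1 g))|].
  etransitivity; [apply corner_u_idm|]; symmetry.
  exact (f_equal (@corner_id X) (dom_corner_g g)).
- etransitivity; [exact (f_equal (@corner_u X) (fmor_id d0 g))|]; apply corner_u_idm.
Qed.
Next Obligation.
intros b a p q; apply sq_ext; apply sig_ext.
- exact (f_equal (@corner_g X) (dom_comp p)).
- exact (f_equal (@corner_g X) (cod_comp p)).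
- assert (r : cod (fmor d1 a) = dom (fmor d1 b)) by now rewrite cod_fmor, dom_fmor, p.
  etransitivity; [exact (f_equal (@corner_u X) (fmor_comp d1 (q := r)))|].
  apply corner_u_comp.
- assert (r : cod (fmor d0 a) = dom (fmor d0 b)) by now rewrite cod_fmor, dom_fmor, p.
  etransitivity; [exact (f_equal (@corner_u X) (fmor_comp d0 (q := r)))|].
  apply corner_u_comp.
Qed.

Program Definition unit_df : DoubleFunctor X (D_double (Cnr_sfs HX)) :=
  {| df0 := unit_df0; df1 := unit_df1 |}.
Next Obligation. now apply sf_ext. Qed.
Next Obligation. apply sf_ext; trivial; exact dom_corner_g. Qed.
Next Obligation.
apply sf_ext; intros x.
- apply sig_ext, corner_g_hunit.
- apply sq_ext; apply sig_ext.
  + etransitivity; [exact (f_equal (@corner_g X) (dom_fmor hunit x))|].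
    apply corner_g_hunit.
  + etransitivity; [exact (f_equal (@corner_g X) (cod_fmor hunit x))|].
    etransitivity; [apply corner_g_hunit|]; symmetry.
    exact (f_equal (@corner_id X) (cod_corner_u x)).
  + exact (f_equal (@corner_u X) (d1um x)).
  + exact (f_equal (@corner_u X) (d0um x)).
Qed.
Next Obligation.
intros e; apply sf_ext; intros [[a b] p]; simpl in p.
- apply sig_ext; exact (corner_g_hcomp p _).
- apply sq_ext; apply sig_ext.
  + assert (r : fob d0 (dom a) = fob d1 (dom b)) by now rewrite <- !dom_fmor, p.
    etransitivity; [exact (f_equal (@corner_g X) (dom_hcomp_sq p r))|].
    apply corner_g_hcomp.
  + assert (r : fob d0 (cod a) = fob d1 (cod b)) by now rewrite <- !cod_fmor, p.
    etransitivity; [exact (f_equal (@corner_g X) (cod_hcomp_sq p r))|].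
    apply corner_g_hcomp.
  + exact (f_equal (@corner_u X) (d1hm p)).
  + exact (f_equal (@corner_u X) (d0hm p)).
Qed.

(** Membership in [Cnr_E] makes the horizontal component an identity, so such a corner is recovered
    from its vertical component. *)
Lemma unitE_bijective : bijective unitE.
Proof.
split.
- intros u v H; exact (f_equal (fun e => cvert (proj1_sig e)) H).
- intros [e He]; exists (cvert e); apply sig_ext, corner_ext; [reflexivity|exact (eq_sym He)].
Qed.

Lemma unitM_bijective : bijective unitM.
Proof.
split.
- intros g h H; exact (f_equal (fun m => chor (proj1_sig m)) H).
- intros [m Hm]; exists (chor m); apply sig_ext, corner_ext; [exact (eq_sym Hm)|reflexivity].
Qed.

(* The left and bottom edges of a square are read off the components of the
   diagonal of its image. *)
Lemma unit_sq_left_bot (s : CommSquare (Cnr_sfs HX)) (a : Mor (X1 X)) :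
  unitM (dom a) = sq_top s -> unitE (fmor d0 a) = sq_right s ->
  unitE (fmor d1 a) = sq_left s /\ unitM (cod a) = sq_bot s.
Proof.
destruct s as [t b l r p q c]; simpl; intros <- <-; simpl in p, c.
destruct (proj2 unitE_bijective l) as [u <-], (proj2 unitM_bijective b) as [h <-].
simpl in q, c.
assert (q' : cod (corner_u (fmor d1 a) : Mor C) = dom (corner_g (cod a) : Mor C)).
{ rewrite cod_corner_u, dom_corner_g; exact (cod_fmor d1 a). }
pose proof (eq_trans (eq_sym (corner_square_comm p q')) c) as E.
destruct (Cnr_comp_EM q (corner_u_E _) (corner_g_M _)) as [H1 H2].
destruct (Cnr_comp_EM q' (corner_u_E _) (corner_g_M _)) as [K1 K2].
split; f_equal.
- exact (eq_trans (eq_sym K1) (eq_trans (f_equal (@cvert X) E) H1)).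
- exact (eq_trans (eq_sym K2) (eq_trans (f_equal (@chor X) E) H2)).
Qed.

(** Two squares with the same image share top and right edges, hence are the same filler.
    Conversely, a commutative square is hit by the filler of the preimages of its top and right
    edges, the other two edges then being forced. *)
Lemma unit_sq_bijective : bijective unit_sq.
Proof.
split.
- intros a b H.
  pose proof (proj1 unitM_bijective _ _ (f_equal (@sq_top _) H)) as Ht.
  pose proof (proj1 unitE_bijective _ _ (f_equal (@sq_right _) H)) as Hr.
  assert (p : fob d0 (dom b) = dom (fmor d0 b)) by now rewrite dom_fmor.
  rewrite <- (filler_unique HX p Ht Hr); now apply filler_unique.
- intros s.
  destruct (proj2 unitM_bijective (sq_top s)) as [g Hg].
  destruct (proj2 unitE_bijective (sq_right s)) as [u Hu].
  assert (p : fob d0 g = dom u).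
  { pose proof (sq_tr s) as H; rewrite <- Hg, <- Hu in H; exact H. }
  exists (filler HX p).
  assert (Ht : unitM (dom (filler HX p)) = sq_top s) by now rewrite dom_filler.
  assert (Hr : unitE (fmor d0 (filler HX p)) = sq_right s) by now rewrite d0_filler.
  destruct (unit_sq_left_bot Ht Hr); now apply sq_ext.
Qed.

End Unit.

(** * Naturality and invertibility of the comparison *)

Lemma corner_map_u (X Y : DoubleCat) (F : DoubleFunctor X Y) (u : Mor (X0 X)) :
  corner_map F (corner_u u) = corner_u (fmor (df0 F) u).
Proof.
apply corner_ext; [reflexivity|].
exact (eq_trans (dfu F (cod u)) (f_equal _ (eq_sym (cod_fmor (df0 F) u)))).
Qed.

Lemma corner_map_g (X Y : DoubleCat) (F : DoubleFunctor X Y) (g : Ob (X1 X)) :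
  corner_map F (corner_g g) = corner_g (fob (df1 F) g).
Proof.
apply corner_ext; [|reflexivity].
exact (eq_trans (fmor_id (df0 F) (fob d1 g)) (f_equal _ (eq_sym (dfd1 F g)))).
Qed.

Lemma unit_iso :
  NatIsomorphic (FunctorId CodDiscr) (FunctorComp DFunctor CnrFunctor).
Proof.
apply NatIsomorphic_pointwise with
  (t := fun X : Obj CodDiscr => unit_df (proj2_sig X)).
- intros [X HX] [Y HY] F; apply df_ext; apply sf_ext; trivial.
  + intros u; apply sig_ext; symmetry; exact (corner_map_u F u).
  + intros g; apply sig_ext; symmetry; exact (corner_map_g F g).
  (* Commutative squares are equal once their four edges are, so this reduces to naturality on
     horizontal and vertical morphisms. *)
  + intros a; apply sq_ext; apply sig_ext; symmetry.
    * etransitivity; [exact (corner_map_g F (dom a))|]; symmetry.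
      exact (f_equal (@corner_g Y) (dom_fmor (df1 F) a)).
    * etransitivity; [exact (corner_map_g F (cod a))|]; symmetry.
      exact (f_equal (@corner_g Y) (cod_fmor (df1 F) a)).
    * etransitivity; [exact (corner_map_u F (fmor d1 a))|]; symmetry.
      exact (f_equal (@corner_u Y) (dfd1m F a)).
    * etransitivity; [exact (corner_map_u F (fmor d0 a))|]; symmetry.
      exact (f_equal (@corner_u Y) (dfd0m F a)).
- intros [X HX]; apply double_functor_inverse.
  + apply bijective_id.
  + apply unitE_bijective.
  + apply unitM_bijective.
  + apply unit_sq_bijective.
Qed.

(** * The comparison functor from [Cnr (D S)] to [S] *)

Section Counit.
Variable S : StrictFactSys.
Let HD := @D_codomain_discrete S.

Lemma sfs_fact_unique (e e' m m' : Mor S) p p' :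
  sfs_E e -> sfs_M m -> sfs_E e' -> sfs_M m' ->
  comp m e p = comp m' e' p' -> e = e' /\ m = m'.
Proof.
intros He Hm He' Hm' E.
destruct (sfs_fact (comp m e p)) as [em [_ U]].
assert (H : (e, m) = (e', m')).
{ rewrite <- (U (e, m)), <- (U (e', m')); trivial; simpl;
    (split; [trivial|split; [trivial|]]); eexists; [exact E|reflexivity]. }
now injection H.
Qed.

Lemma corner_diag_eq (f : Corner (D_double S)) :
  cod (proj1_sig (cvert f)) = dom (proj1_sig (chor f)).
Proof. exact (corner_eq f). Qed.

Definition corner_diag (f : Corner (D_double S)) : Mor S :=
  comp (proj1_sig (chor f)) (proj1_sig (cvert f)) (corner_diag_eq f).

(* Interchange of the middle factors of a composite [h ∘ v ∘ g ∘ u]. *)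
Lemma comp_interchange (h v b g l u : Mor S) p q p1 p2 p3 p4 r r' :
  comp v g p = comp b l q ->
  comp (comp h v p1) (comp g u p2) r = comp (comp h b p3) (comp l u p4) r'.
Proof.
(* Rebracketing as [h ∘ ((v ∘ g) ∘ u)] isolates the middle factors. The pair [v], [g] is generalized
   so that the same equation also serves for [b], [l]. *)
assert (E : forall (v g : Mor S) p p1 p2 r s s',
  comp (comp h v p1) (comp g u p2) r = comp h (comp (comp v g p) u s) s').
{ clear; intros v g p p1 p2 r s s'.
  assert (x : cod (comp g u p2) = dom v) by now rewrite cod_comp.
  assert (y : cod (comp v (comp g u p2) x) = dom h) by now rewrite cod_comp.
  rewrite (comp_assoc (p := x) (q := p1) r y).
  apply comp_ext; trivial; symmetry; apply comp_assoc. }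
intros H.
assert (s1 : cod u = dom (comp v g p)) by now rewrite dom_comp.
assert (s2 : cod (comp (comp v g p) u s1) = dom h) by now rewrite !cod_comp.
assert (s3 : cod u = dom (comp b l q)) by now rewrite dom_comp.
assert (s4 : cod (comp (comp b l q) u s3) = dom h) by now rewrite !cod_comp.
rewrite (E _ _ p p1 p2 r s1 s2), (E _ _ q p3 p4 r' s3 s4).
apply comp_ext; trivial; now apply comp_ext.
Qed.

Program Definition counit_sf : SmallFunctor (Cnr HD) S :=
  {| fob := fun a : Ob (Cnr HD) => a : Ob S;
     fmor := fun f : Mor (Cnr HD) => corner_diag f |}.
Next Obligation. intros f; exact (dom_comp (corner_diag_eq f)). Qed.
Next Obligation. intros f; exact (cod_comp (corner_diag_eq f)). Qed.
Next Obligation.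
intros a; unfold corner_diag; simpl.
etransitivity; [|apply comp_id_r]; apply comp_ext; trivial; simpl; now rewrite dom_idm.
Unshelve. apply cod_idm.
Qed.
Next Obligation.
intros g f p q; unfold corner_diag; simpl.
(* Corners compose by replacing the middle pair, top then right edge, with the left and bottom edges
   of the filler. The filler is a commutative square of [S], so the diagonal is unchanged. *)
symmetry; apply (comp_interchange (p := p) (q := sq_lb (filler HD p))).
rewrite <- sq_comm; apply comp_ext; f_equal; symmetry.
- exact (d0_filler HD p).
- exact (dom_filler HD p).
Qed.

Program Definition counit_sfsf : SFSFunctor (Cnr_sfs HD) S :=
  {| sfs_functor := counit_sf |}.
Next Obligation.
intros f Hf; simpl; unfold corner_diag; hnf in Hf.
apply E_comp; [rewrite Hf; apply E_id | apply proj2_sig].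
Qed.
Next Obligation.
intros f Hf; simpl; unfold corner_diag; hnf in Hf.
apply M_comp; [apply proj2_sig | rewrite Hf; apply M_id].
Qed.

Lemma corner_diag_bijective : bijective corner_diag.
Proof.
split.
- intros f f' H.
  destruct (sfs_fact_unique (proj2_sig (cvert f)) (proj2_sig (chor f))
              (proj2_sig (cvert f')) (proj2_sig (chor f')) H) as [H1 H2].
  apply corner_ext; now apply sig_ext.
- intros f; destruct (sfs_fact f) as [[e m] [[He [Hm [p Hp]]] _]]; simpl in *.
  pose (u := exist _ e He : EMor S); pose (g := exist _ m Hm : MMor S).
  exists (exist _ (u : Mor (X0 (D_double S)), g : Ob (X1 (D_double S))) p).
  rewrite Hp; now apply comp_ext.
Qed.

(** If the diagonal lies in the left class, an identity after it is a second factorization of it;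
    uniqueness makes the horizontal component an identity. *)
Lemma counit_reflects_E (f : Mor (Cnr HD)) : sfs_E (corner_diag f) -> Cnr_E f.
Proof.
intros Hf.
assert (p : cod (corner_diag f) = dom (idm (cod (corner_diag f)))) by now rewrite dom_idm.
destruct (sfs_fact_unique (p := corner_diag_eq f) (p' := p) (proj2_sig (cvert f))
  (proj2_sig (chor f)) Hf (M_id _)) as [_ H].
{ now rewrite comp_id_l. }
apply sig_ext; simpl; rewrite H; f_equal.
(* The identity found sits at the codomain of the diagonal, which has to be matched with the
   codomain of the vertical component. *)
etransitivity; [|symmetry; exact (corner_diag_eq f)]; simpl; now rewrite H, dom_idm.
Qed.

(** Dually, the diagonal is compared with its factorization through an identity on its domain. *)
Lemma counit_reflects_M (f : Mor (Cnr HD)) : sfs_M (corner_diag f) -> Cnr_M f.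
Proof.
intros Hf.
assert (p : cod (idm (dom (corner_diag f))) = dom (corner_diag f)) by now rewrite cod_idm.
destruct (sfs_fact_unique (p := corner_diag_eq f) (p' := p) (proj2_sig (cvert f))
  (proj2_sig (chor f)) (E_id _) Hf) as [H _].
{ now rewrite comp_id_r. }
apply sig_ext; simpl; rewrite H; f_equal.
etransitivity; [|exact (corner_diag_eq f)]; simpl; now rewrite H, cod_idm.
Qed.

End Counit.

Lemma counit_iso :
  NatIsomorphic (FunctorComp CnrFunctor DFunctor) (FunctorId SFS).
Proof.
apply NatIsomorphic_pointwise with (t := fun S : Obj SFS => counit_sfsf S).
- intros S T F; apply sfsf_ext, sf_ext; trivial.
  (* On a corner [[u, g]], naturality says that [F] preserves the composite [g ∘ u]. *)
  intros f; symmetry; simpl; unfold corner_diag; apply fmor_comp.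
- intros S; apply sfs_functor_inverse.
  + apply bijective_id.
  + apply corner_diag_bijective.
  + apply counit_reflects_E.
  + apply counit_reflects_M.
Qed.

Theorem theorem3p7 :
  NatIsomorphic (FunctorId CodDiscr) (FunctorComp DFunctor CnrFunctor) /\
  NatIsomorphic (FunctorComp CnrFunctor DFunctor) (FunctorId SFS) /\
  EquivalentCategories SFS CodDiscr.
Proof.
split; [exact unit_iso|split; [exact counit_iso|]].
(* Starting from [SFS], the two isomorphisms exchange roles and are needed in the opposite
   direction. *)
exists DFunctor, CnrFunctor; split; apply NatIsomorphic_sym.
- exact counit_iso.
- exact unit_iso.
Qed.
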